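(* Let $(H,\alpha)$ be a monoidal Hom-Hopf algebra over a field $k$ with bijective antipode $S$, and let $G=\mathrm{Aut}_{mHH}(H)\times \mathrm{Aut}_{mHH}(H)$ be the group with multiplication $(A,B)\ast(C,D)=(AC,\,DC^{-1}BC)$. Let $\mathcal{MHYD}(H)$ be the disjoint union of the categories ${}_H\mathcal{MHYD}^H(A,B)$, $(A,B)\in G$, equipped with the tensor product, unit, constraints, conjugation functors $\varphi_{(A,B)}$ and family $c=(c_{M,N})$ described in the context. Then $\mathcal{MHYD}(H)$ is a braided $T$-category over $G$.
   Context: Sweedler notation is used: $\Delta(c)=c_1\otimes c_2$, $(\mathrm{id}\otimes\Delta)\Delta(c)=c_1\otimes c_{21}\otimes c_{22}$, $(\Delta\otimes \mathrm{id})\Delta(c)=c_{11}\otimes c_{12}\otimes c_2$, etc. Everything is over a field $k$. **Monoidal Hom-Hopf algebras.** A monoidal Hom-algebra $(A,\alpha)$ is a vector space $A$ with $\alpha\in \mathrm{Aut}_k(A)$ (linear automorphism), a multiplication $A\otimes A\to A$ and $1_A\in A$ such that $\alpha(a)(bc)=(ab)\alpha(c)$, $\alpha(ab)=\alpha(a)\alpha(b)$, $a1_A=1_Aa=\alpha(a)$, $\alpha(1_A)=1_A$. A monoidal Hom-coalgebra $(C,\gamma)$ is a vector space $C$ with $\gamma\in\mathrm{Aut}_k(C)$ and linear maps $\Delta:C\to C\otimes C$, $\varepsilon:C\to k$ such that $\gamma^{-1}(c_1)\otimes\Delta(c_2)=\Delta(c_1)\otimes\gamma^{-1}(c_2)$,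 $\Delta(\gamma(c))=\gamma(c_1)\otimes\gamma(c_2)$, $c_1\varepsilon(c_2)=\gamma^{-1}(c)=\varepsilon(c_1)c_2$, $\varepsilon(\gamma(c))=\varepsilon(c)$. A monoidal Hom-bialgebra $(H,\alpha)$ is both (with the same $\alpha$), with $\Delta(hg)=\Delta(h)\Delta(g)$, $\Delta(1_H)=1_H\otimes 1_H$, $\varepsilon(hg)=\varepsilon(h)\varepsilon(g)$, $\varepsilon(1_H)=1$. It is a monoidal Hom-Hopf algebra if there is a linear map (antipode) $S:H\to H$ with $S\alpha=\alpha S$ and $S(h_1)h_2=\varepsilon(h)1_H=h_1S(h_2)$. $\mathrm{Aut}_{mHH}(H)$ is the group of automorphisms of the monoidal Hom-Hopf algebra $H$: bijective linear maps preserving multiplication, unit, comultiplication and counit, and commuting with $\alpha$ and $S$; products such as $AC$ denote composition. **Hom-modules and Hom-comodules.** A left $H$-Hom-module $(M,\mu)$ is a vector space $M$ with $\mu\in\mathrm{Aut}_k(M)$ and an action $h\otimes m\mapsto h\cdot m$ with $\alpha(a)\cdot(b\cdot m)=(ab)\cdot\mu(m)$, $\mu(a\cdot m)=\alpha(a)\cdot\mu(m)$, $1_H\cdot m=\mu(m)$. A right $H$-Hom-comodule $(M,\mu)$ has a coaction $\rho(m)=m_{(0)}\otimes m_{(1)}\in M\otimes H$ with $\mu^{-1}(m_{(0)})\otimes\Delta(m_{(1)})=(m_{(0)(0)}\otimes m_{(0)(1)})\otimes\alpha^{-1}(m_{(1)})$, $\rho(\mu(m))=\mu(m_{(0)})\otimes\alpha(m_{(1)})$,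 $m_{(0)}\varepsilon(m_{(1)})=\mu^{-1}(m)$. $H$-linear (resp. $H$-colinear) maps $f:(M,\mu)\to(N,\nu)$ are linear maps that preserve the action (resp. coaction) and satisfy $f\mu=\nu f$. **Twisted Yetter-Drinfeld Hom-modules.** For $A,B\in\mathrm{Aut}_{mHH}(H)$, a left-right $(A,B)$-Yetter-Drinfeld Hom-module is a vector space $M$ with $\mu\in \mathrm{Aut}_k(M)$, being a left $H$-Hom-module $(M,\cdot,\mu)$ and a right $H$-Hom-comodule $(M,\rho,\mu)$ such that for all $h\in H,m\in M$ $$\rho(h\cdot m)=\alpha(h_{21})\cdot m_{(0)}\otimes (B(h_{22})\alpha^{-1}(m_{(1)}))A(S^{-1}(h_1)).$$ ${}_H\mathcal{MHYD}^H(A,B)$ is the category of these, with $H$-linear $H$-colinear maps as morphisms. **Structure on $\mathcal{MHYD}(H)$.** - Tensor product: for $(M,\mu)\in{}_H\mathcal{MHYD}^H(A,B)$, $(N,\nu)\in{}_H\mathcal{MHYD}^H(C,D)$, $(M\otimes N,\mu\otimes\nu)\in{}_H\mathcal{MHYD}^H((A,B)\ast(C,D))$ has action $h\cdot(m\otimes n)=C(h_1)\cdot m\otimes C^{-1}BC(h_2)\cdot n$ and coaction $m\otimes n\mapsto (m_{(0)}\otimes n_{(0)})\otimes n_{(1)}m_{(1)}$. - Unit: $k$ (with $\mu=\mathrm{id}$, action $h\cdot 1=\varepsilon(h)$, coaction $1\mapsto 1\otimes 1_H$). - Constraints, for $(M,\mu),(N,\nu),(P,\varsigma)$: $a_{M,N,P}((m\otimes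 n)\otimes p)=\mu(m)\otimes(n\otimes\varsigma^{-1}(p))$, $l_M(1\otimes m)=\mu(m)$, $r_M(m\otimes 1)=\mu(m)$. - Conjugation: $\varphi_{(A,B)}:{}_H\mathcal{MHYD}^H(C,D)\to{}_H\mathcal{MHYD}^H((A,B)\ast(C,D)\ast(A,B)^{-1})$, $\varphi_{(A,B)}(N)={}^{(A,B)}N$, identity on morphisms, where ${}^{(A,B)}N=N$ as a vector space (with the same $\nu$), with action $h\rhd n=C^{-1}BCA^{-1}(h)\cdot n$ and coaction $n\mapsto n_{(0)}\otimes AB^{-1}(n_{(1)})$. - Braiding: for $M\in{}_H\mathcal{MHYD}^H(A,B)$ and ${}^MN:={}^{(A,B)}N$, $c_{M,N}:M\otimes N\to{}^MN\otimes M$, $c_{M,N}(m\otimes n)=\nu(n_{(0)})\otimes B^{-1}(n_{(1)})\cdot\mu^{-1}(m)$. **Braided $T$-category over a group $G$.** A crossed category over $G$ is a monoidal category $\mathcal C$ which is a disjoint union of subcategories $\{\mathcal C_\alpha\}_{\alpha\in G}$ such that $U\otimes V\in\mathcal C_{\alpha\beta}$ for $U\in\mathcal C_\alpha$, $V\in\mathcal C_\beta$, together with a group homomorphism $\varphi:G\to\mathrm{Aut}(\mathcal C)$, $\beta\mapsto\varphi_\beta$, into the group of invertible strict tensor functors $\mathcal C\to\mathcal C$, with $\varphi_\beta(\mathcal C_\alpha)=\mathcal C_{\beta\alpha\beta^{-1}}$. For $U\in\mathcal C_\alpha$ write ${}^U(\cdot)={}^\alpha(\cdot)=\varphi_\alpha$.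 A braiding is a family of isomorphisms $c_{U,V}:U\otimes V\to{}^UV\otimes U$ such that: (a) for $f\in\mathcal C_\alpha(U,U')$ and $g\in\mathcal C(V,V')$, $(({}^\alpha g)\otimes f)\circ c_{U,V}=c_{U',V'}\circ(f\otimes g)$; (b) for all $U,V,W$, $$c_{U\otimes V,W}=a_{{}^{U\otimes V}W,U,V}\circ(c_{U,{}^VW}\otimes \mathrm{id}_V)\circ a^{-1}_{U,{}^VW,V}\circ(\mathrm{id}_U\otimes c_{V,W})\circ a_{U,V,W},$$ $$c_{U,V\otimes W}=a^{-1}_{{}^UV,{}^UW,U}\circ(\mathrm{id}_{{}^UV}\otimes c_{U,W})\circ a_{{}^UV,U,W}\circ(c_{U,V}\otimes\mathrm{id}_W)\circ a^{-1}_{U,V,W};$$ (c) $\varphi_\beta(c_{U,V})=c_{\varphi_\beta(U),\varphi_\beta(V)}$ for all $U,V$ and $\beta\in G$. A braided $T$-category over $G$ is a crossed category over $G$ endowed with a braiding. *)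

(* Defs.v *)
From HB Require Import structures.
From mathcomp Require Import all_boot all_algebra.
From mathcomp Require Import boolp.

Set Implicit Arguments.
Unset Strict Implicit.
Unset Printing Implicit Defensive.

Import GRing.Theory.
Local Open Scope ring_scope.
Local Open Scope quotient_scope.

(* Tensor products of vector spaces.  An element of [tensor U V] is a class of
   formal sums u_1 ⊗ v_1 + ... + u_n ⊗ v_n (lists of pairs); two formal sums
   are identified when every bilinear map out of U x V takes the same value on
   them.  The universal property is [sweedler_tens], [sweedler_is_linear] and
   [tensor_ind]. *)
Section Tensor.
Variables (k : fieldType) (U V : lmodType k).

Notation formal_sum := (seq (U * V)).

Definition fs_eval (W : lmodType k) (b : U -> V -> W) (s : formal_sum) : W :=
  \sum_(p <- s) b p.1 p.2.

Definition fs_equiv (s t : formal_sum) : bool :=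
  `[< forall (W : lmodType k) (b : U -> V -> W),
        bilinear_for *:%R *:%R b -> fs_eval b s = fs_eval b t >].

Lemma fs_equivP s t : reflect (forall (W : lmodType k) (b : U -> V -> W),
  bilinear_for *:%R *:%R b -> fs_eval b s = fs_eval b t) (fs_equiv s t).
Proof. exact: asboolP. Qed.

Lemma fs_equiv_refl : reflexive fs_equiv.
Proof. by move=> s; apply/fs_equivP. Qed.
Lemma fs_equiv_sym : symmetric fs_equiv.
Proof.
by move=> s t; apply/fs_equivP/fs_equivP => e W b hb; rewrite e.
Qed.
Lemma fs_equiv_trans : transitive fs_equiv.
Proof.
move=> t s u /fs_equivP st /fs_equivP tu; apply/fs_equivP => W b hb.
by rewrite st // tu.
Qed.

Canonical fs_equiv_rel :=
  EquivRel fs_equiv fs_equiv_refl fs_equiv_sym fs_equiv_trans.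

Definition tensor := {eq_quot fs_equiv}.
HB.instance Definition _ := Choice.on tensor.
HB.instance Definition _ := EqQuotient.on tensor.

Definition tens (u : U) (v : V) : tensor := \pi_tensor [:: (u, v)].

(* The Sweedler sum: if x = u_1 ⊗ v_1 + ... + u_n ⊗ v_n, then
   [sweedler b x] is b u_1 v_1 + ... + b u_n v_n.  It is computed on a chosen
   representative, hence meaningful only for bilinear b. *)
Definition sweedler (W : lmodType k) (b : U -> V -> W) (x : tensor) : W :=
  fs_eval b (repr x).

Lemma sweedler_pi (W : lmodType k) (b : U -> V -> W) s :
  bilinear_for *:%R *:%R b -> sweedler b (\pi_tensor s) = fs_eval b s.
Proof.
move=> hb; apply: (fs_equivP (repr (\pi_tensor s)) s _) => //.
by have /eqmodP := reprK (\pi_tensor s).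
Qed.

Lemma tensor_eq (x y : tensor) :
  (forall (W : lmodType k) (b : U -> V -> W),
    bilinear_for *:%R *:%R b -> sweedler b x = sweedler b y) -> x = y.
Proof.
rewrite -[x]reprK -[y]reprK => h; apply/eqmodP/fs_equivP => W b hb.
by rewrite -!sweedler_pi // h.
Qed.

Definition tensor_zero : tensor := \pi_tensor [::].
Definition tensor_add (x y : tensor) : tensor := \pi_tensor (repr x ++ repr y).
Definition tensor_scale (c : k) (x : tensor) : tensor :=
  \pi_tensor [seq (c *: p.1, p.2) | p <- repr x].

Lemma sweedler_zero (W : lmodType k) (b : U -> V -> W) :
  bilinear_for *:%R *:%R b -> sweedler b tensor_zero = 0.
Proof. by move=> hb; rewrite sweedler_pi // /fs_eval big_nil. Qed.

Lemma sweedler_add (W : lmodType k) (b : U -> V -> W) x y :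
  bilinear_for *:%R *:%R b ->
  sweedler b (tensor_add x y) = sweedler b x + sweedler b y.
Proof. by move=> hb; rewrite sweedler_pi // /fs_eval big_cat. Qed.

Lemma bilinear_scalel (W : lmodType k) (b : U -> V -> W) c u v :
  bilinear_for *:%R *:%R b -> b (c *: u) v = c *: b u v.
Proof.
move=> [hb _]; have b0 : b 0 v = 0.
  have e := hb v 1 0 0; rewrite /= !scale1r !addr0 in e.
  by apply: (addrI (b 0 v)); rewrite addr0 -e.
by have := hb v c u 0; rewrite !addr0 b0 addr0.
Qed.

Lemma sweedler_scale (W : lmodType k) (b : U -> V -> W) c x :
  bilinear_for *:%R *:%R b ->
  sweedler b (tensor_scale c x) = c *: sweedler b x.
Proof.
move=> hb; rewrite sweedler_pi // /fs_eval big_map scaler_sumr.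
by apply: eq_bigr => p _ /=; apply: bilinear_scalel.
Qed.

Let sweedlerE := (sweedler_zero, sweedler_add, sweedler_scale).

Fact tensor_addA : associative tensor_add.
Proof. by move=> x y z; apply: tensor_eq => W b hb; rewrite !sweedlerE ?addrA. Qed.
Fact tensor_addC : commutative tensor_add.
Proof. by move=> x y; apply: tensor_eq => W b hb; rewrite !sweedlerE // addrC. Qed.
Fact tensor_add0 : left_id tensor_zero tensor_add.
Proof. by move=> x; apply: tensor_eq => W b hb; rewrite !sweedlerE // add0r. Qed.
Fact tensor_addN :
  left_inverse tensor_zero (tensor_scale (-1)) tensor_add.
Proof.
move=> x; apply: tensor_eq => W b hb; rewrite !sweedlerE // scaleN1r.
exact: addNr.
Qed.

HB.instance Definition _ := GRing.isZmodule.Build tensor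
  tensor_addA tensor_addC tensor_add0 tensor_addN.

Fact tensor_scaleA c d x :
  tensor_scale c (tensor_scale d x) = tensor_scale (c * d) x.
Proof. by apply: tensor_eq => W b hb; rewrite !sweedlerE // scalerA. Qed.
Fact tensor_scale1 : left_id 1 tensor_scale.
Proof. by move=> x; apply: tensor_eq => W b hb; rewrite !sweedlerE // scale1r. Qed.
Fact tensor_scaleDr : right_distributive tensor_scale +%R.
Proof.
move=> c x y; apply: tensor_eq => W b hb.
by rewrite !(sweedlerE, sweedler_add) // scalerDr.
Qed.
Fact tensor_scaleDl x : {morph tensor_scale^~ x : c d / c + d}.
Proof.
move=> c d; apply: tensor_eq => W b hb.
by rewrite !(sweedlerE, sweedler_add) // scalerDl.
Qed.

HB.instance Definition _ := GRing.Zmodule_isLmodule.Build k tensor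
  tensor_scaleA tensor_scale1 tensor_scaleDr tensor_scaleDl.

Lemma sweedler_tens (W : lmodType k) (b : U -> V -> W) u v :
  bilinear_for *:%R *:%R b -> sweedler b (tens u v) = b u v.
Proof. by move=> hb; rewrite sweedler_pi // /fs_eval big_seq1. Qed.

Lemma sweedler_is_linear (W : lmodType k) (b : U -> V -> W) :
  bilinear_for *:%R *:%R b -> linear (sweedler b).
Proof.
by move=> hb c x y; rewrite [LHS]sweedler_add // sweedler_scale.
Qed.

Lemma tens_is_bilinear : bilinear_for *:%R *:%R tens.
Proof.
split=> [v|u] c x y; apply: tensor_eq => W b hb;
  rewrite [RHS]sweedler_add // sweedler_scale // !sweedler_tens //.
- by have [-> _] := hb.
- by have [_ ->] := hb.
Qed.

Lemma tensor_ind (P : tensor -> Prop) :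
  P 0 -> (forall u v x, P x -> P (tens u v + x)) -> forall x, P x.
Proof.
move=> P0 Pc x; rewrite -[x]reprK; elim: (repr x) => [|[u v] s IHs] //.
rewrite [X in P X](_ : _ = tens u v + \pi_tensor s); first exact: Pc.
apply: tensor_eq => W b hb; rewrite [RHS]sweedler_add // sweedler_tens //.
by rewrite !sweedler_pi // /fs_eval big_cons.
Qed.

End Tensor.

Notation "u ⊗ v" := (tens u v) (at level 40, left associativity) : ring_scope.
Notation "\sw_ ( u , v <- x ) F" := (sweedler (fun u v => F) x)
  (at level 41, u name, v name, x at level 10, F at level 41,
   format "\sw_ ( u ,  v  <-  x )  F") : ring_scope.

Section TensorMap.
Variable k : fieldType.
Implicit Types U V W : lmodType k.

Definition tmap U V U' V' (f : U -> U') (g : V -> V') (x : tensor U V) :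
  tensor U' V' := \sw_(u, v <- x) f u ⊗ g v.

Lemma tens_bilinear U V U' V' (f : U -> U') (g : V -> V') :
  linear f -> linear g -> bilinear_for *:%R *:%R (fun u v => f u ⊗ g v).
Proof.
move=> hf hg; split=> [v|u] c x y /=; have [hl hr] := tens_is_bilinear U' V'.
- by rewrite hf hl.
- by rewrite hg hr.
Qed.

Lemma tmap_tens U V U' V' (f : U -> U') (g : V -> V') u v :
  linear f -> linear g -> tmap f g (u ⊗ v) = f u ⊗ g v.
Proof. by move=> hf hg; rewrite /tmap sweedler_tens //; apply: tens_bilinear. Qed.

Lemma tmap_is_linear U V U' V' (f : U -> U') (g : V -> V') :
  linear f -> linear g -> linear (tmap f g).
Proof. by move=> hf hg; apply/sweedler_is_linear/tens_bilinear. Qed.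

Lemma linear_0 U V (f : U -> V) : linear f -> f 0 = 0.
Proof.
move=> hf; have e := hf 1 0 0; rewrite /= !scale1r !addr0 in e.
by apply: (addrI (f 0)); rewrite addr0 -e.
Qed.

Lemma linear_D U V (f : U -> V) x y : linear f -> f (x + y) = f x + f y.
Proof. by move=> hf; have := hf 1 x y; rewrite !scale1r. Qed.

Lemma tensor_ext U V W (f g : tensor U V -> W) : linear f -> linear g ->
  (forall u v, f (u ⊗ v) = g (u ⊗ v)) -> f =1 g.
Proof.
move=> hf hg fg; elim/tensor_ind => [|u v x fgx]; first by rewrite !linear_0.
by rewrite !linear_D // fg fgx.
Qed.

Lemma comp_linear U V W (g : V -> W) (f : U -> V) :
  linear g -> linear f -> linear (fun x => g (f x)).
Proof. by move=> hg hf c x y; rewrite hf hg. Qed.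

Lemma tmap_comp U V U' V' U2 V2 (f : U -> U') (g : V -> V')
    (f' : U' -> U2) (g' : V' -> V2) :
  linear f -> linear g -> linear f' -> linear g' ->
  forall x, tmap f' g' (tmap f g x) =
            tmap (fun u => f' (f u)) (fun v => g' (g v)) x.
Proof.
move=> hf hg hf' hg'; have hff := comp_linear hf' hf.
have hgg := comp_linear hg' hg.
apply: tensor_ext; [|exact: tmap_is_linear|by move=> u v; rewrite !tmap_tens].
by apply: comp_linear; apply: tmap_is_linear.
Qed.

Lemma tmap_id U V (f : U -> U) (g : V -> V) :
  f =1 id -> g =1 id -> tmap f g =1 id.
Proof.
move=> hf hg; have -> : f = id by apply/funext.
have -> : g = id by apply/funext.
by apply: tensor_ext => // [|u v]; [apply: tmap_is_linear|rewrite tmap_tens].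
Qed.

(* Aut_k(V); the inverse is part of the data, but is determined by the map. *)
Record linAut (V : lmodType k) := LinAut {
  aut_fun :> V -> V;
  autV : V -> V;
  aut_linear : linear aut_fun;
  autK : cancel aut_fun autV;
  autVK : cancel autV aut_fun
}.

Lemma autV_linear V (f : linAut V) : linear (autV f).
Proof.
by move=> c x y; apply: (can_inj (autK f)); rewrite aut_linear !autVK.
Qed.

Lemma linAut_eq V (f g : linAut V) : f =1 g -> f = g.
Proof.
case: f g => [f f' lf fK f'K] [g g' lg gK g'K] /= /funext fg.
subst g; have e : f' = g' by apply/funext => x; rewrite -{1}[x]g'K fK.
by subst g'; congr LinAut; apply: Prop_irrelevance.
Qed.

Definition aut_id V : linAut V :=
  @LinAut V id id (fun _ _ _ => erefl) (fun _ => erefl) (fun _ => erefl).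

Definition aut_comp V (f g : linAut V) : linAut V :=
  LinAut (comp_linear (aut_linear f) (aut_linear g))
    (can_comp (autK f) (autK g)) (can_comp (autVK g) (autVK f)).

Definition aut_inv V (f : linAut V) : linAut V :=
  LinAut (autV_linear f) (autVK f) (autK f).

Lemma tmapK U V (f : linAut U) (g : linAut V) :
  cancel (tmap f g) (tmap (autV f) (autV g)).
Proof.
move=> x; rewrite tmap_comp; try exact: aut_linear; try exact: autV_linear.
by apply: tmap_id => y; rewrite autK.
Qed.

Definition tmap_aut U V (f : linAut U) (g : linAut V) : linAut (tensor U V) :=
  LinAut (tmap_is_linear (aut_linear f) (aut_linear g))
    (tmapK f g) (tmapK (aut_inv f) (aut_inv g)).

End TensorMap.

Section HomHopf.
Variable k : fieldType.

Record is_homAlgebra (A : lmodType k) (al : linAut A)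
    (mul : {bilinear A -> A -> A}) (one : A) : Prop := {
  homalg_mulA : forall a b c, mul (al a) (mul b c) = mul (mul a b) (al c);
  homalg_autM : forall a b, al (mul a b) = mul (al a) (al b);
  homalg_mulr1 : forall a, mul a one = al a;
  homalg_mul1r : forall a, mul one a = al a;
  homalg_aut1 : al one = one
}.

(* (C ⊗ C) ⊗ C and C ⊗ (C ⊗ C) are identified in the usual way. *)
Record is_homCoalgebra (C : lmodType k) (ga : linAut C)
    (Delta : {linear C -> tensor C C}) (eps : {scalar C}) : Prop := {
  homcoalg_coassoc : forall c,
    \sw_(c1, c2 <- Delta c) autV ga c1 ⊗ Delta c2 =
    \sw_(c1, c2 <- Delta c) \sw_(c11, c12 <- Delta c1)
      c11 ⊗ (c12 ⊗ autV ga c2);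
  homcoalg_autD : forall c,
    Delta (ga c) = \sw_(c1, c2 <- Delta c) ga c1 ⊗ ga c2;
  homcoalg_counitr : forall c, \sw_(c1, c2 <- Delta c) eps c2 *: c1 = autV ga c;
  homcoalg_counitl : forall c, \sw_(c1, c2 <- Delta c) eps c1 *: c2 = autV ga c;
  homcoalg_auteps : forall c, eps (ga c) = eps c
}.

Record is_homBialgebra (H : lmodType k) (al : linAut H)
    (mul : {bilinear H -> H -> H}) (one : H)
    (Delta : {linear H -> tensor H H}) (eps : {scalar H}) : Prop := {
  hombialg_alg : is_homAlgebra al mul one;
  hombialg_coalg : is_homCoalgebra al Delta eps;
  hombialg_DeltaM : forall h g, Delta (mul h g) =
    \sw_(h1, h2 <- Delta h) \sw_(g1, g2 <- Delta g) mul h1 g1 ⊗ mul h2 g2;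
  hombialg_Delta1 : Delta one = one ⊗ one;
  hombialg_epsM : forall h g, eps (mul h g) = eps h * eps g;
  hombialg_eps1 : eps one = 1
}.

Record is_antipode (H : lmodType k) (al : linAut H)
    (mul : {bilinear H -> H -> H}) (one : H)
    (Delta : {linear H -> tensor H H}) (eps : {scalar H})
    (S : {linear H -> H}) : Prop := {
  antipode_aut : forall h, S (al h) = al (S h);
  antipode_left : forall h, \sw_(h1, h2 <- Delta h) mul (S h1) h2 = eps h *: one;
  antipode_right : forall h, \sw_(h1, h2 <- Delta h) mul h1 (S h2) = eps h *: one
}.

Record homHopf := HomHopf {
  hopf_car :> lmodType k;
  halpha : linAut hopf_car;
  hmul : {bilinear hopf_car -> hopf_car -> hopf_car};
  hone : hopf_car;
  hDelta : {linear hopf_car -> tensor hopf_car hopf_car};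
  heps : {scalar hopf_car};
  hS : {linear hopf_car -> hopf_car};
  hopf_bialg : is_homBialgebra halpha hmul hone hDelta heps;
  hopf_antipode : is_antipode halpha hmul hone hDelta heps hS
}.

End HomHopf.

Arguments halpha {k h}.
Arguments hmul {k h}.
Arguments hone {k h}.
Arguments hDelta {k h}.
Arguments heps {k h}.
Arguments hS {k} h.

(* The inverse of f when f is bijective; unspecified otherwise. *)
Definition inverse_map (T : Type) (f : T -> T) (y : T) : T :=
  if pselect (exists x, f x = y) is left ex then sval (cid ex) else y.

Lemma inverse_mapVK (T : Type) (f : T -> T) :
  bijective f -> cancel (inverse_map f) f.
Proof.
move=> [g _ gK] y; rewrite /inverse_map; case: pselect => [ex|[]].
  exact: (svalP (cid ex)).
by exists (g y).
Qed.

Lemma inverse_mapK (T : Type) (f : T -> T) :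
  bijective f -> cancel f (inverse_map f).
Proof.
by move=> bf x; apply: (bij_inj bf); rewrite inverse_mapVK.
Qed.

Section HopfAut.
Variables (k : fieldType) (H : homHopf k).

Record hopfAut := HopfAut {
  haut :> linAut H;
  hautM : forall h g, haut (hmul h g) = hmul (haut h) (haut g);
  haut1 : haut hone = hone;
  hautD : forall h,
    hDelta (haut h) = \sw_(h1, h2 <- hDelta h) haut h1 ⊗ haut h2;
  haut_eps : forall h, heps (haut h) = heps h;
  haut_alpha : forall h, haut (halpha h) = halpha (haut h);
  haut_S : forall h, haut (hS H h) = hS H (haut h)
}.

Lemma hopfAut_eq (f g : hopfAut) : f =1 g -> f = g.
Proof.
case: f g => [f a b c d e i] [g a' b' c' d' e' i'] /linAut_eq fg.
by rewrite /= in fg; subst g; congr HopfAut; apply: Prop_irrelevance.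
Qed.

HB.instance Definition _ := gen_eqMixin hopfAut.
HB.instance Definition _ := gen_choiceMixin hopfAut.

Definition hopfAut_one : hopfAut.
Proof.
apply: (@HopfAut (aut_id H)) => //= h.
by rewrite -[RHS]/(tmap id id (hDelta h)) tmap_id.
Defined.

Definition hopfAut_mul (f g : hopfAut) : hopfAut.
Proof.
apply: (@HopfAut (aut_comp f g)) => /= [h h'||h|h|h|h].
- by rewrite !hautM.
- by rewrite !haut1.
- rewrite !hautD -/(tmap f f _) -/(tmap g g _) tmap_comp //; exact: aut_linear.
- by rewrite !haut_eps.
- by rewrite !haut_alpha.
- by rewrite !haut_S.
Defined.

Definition hopfAut_inv (f : hopfAut) : hopfAut.
Proof.
apply: (@HopfAut (aut_inv f)) => /= [h h'||h|h|h|h].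
- by apply: (can_inj (autK f)); rewrite hautM !autVK.
- by apply: (can_inj (autK f)); rewrite haut1 autVK.
- by rewrite -[in RHS](autVK f h) hautD; exact/esym/(tmapK f f).
- by rewrite -[in RHS](autVK f h) haut_eps.
- by apply: (can_inj (autK f)); rewrite haut_alpha !autVK.
- by apply: (can_inj (autK f)); rewrite haut_S !autVK.
Defined.

Fact hopfAut_mulA : associative hopfAut_mul.
Proof. by move=> f g h; apply: hopfAut_eq. Qed.
Fact hopfAut_mul1 : left_id hopfAut_one hopfAut_mul.
Proof. by move=> f; apply: hopfAut_eq. Qed.
Fact hopfAut_mulr1 : right_id hopfAut_one hopfAut_mul.
Proof. by move=> f; apply: hopfAut_eq. Qed.
Fact hopfAut_mulV : left_inverse hopfAut_one hopfAut_inv hopfAut_mul.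
Proof. by move=> f; apply: hopfAut_eq => x /=; rewrite autK. Qed.
Fact hopfAut_mulrV : right_inverse hopfAut_one hopfAut_inv hopfAut_mul.
Proof. by move=> f; apply: hopfAut_eq => x /=; rewrite autVK. Qed.

HB.instance Definition _ := isGroup.Build hopfAut
  hopfAut_mulA hopfAut_mul1 hopfAut_mulr1 hopfAut_mulV hopfAut_mulrV.

(* The set Aut_mHH(H) x Aut_mHH(H), carrying the twisted product. *)
Record autPair := AutPair { gA : hopfAut; gB : hopfAut }.

Lemma autPair_eq (g h : autPair) : gA g = gA h -> gB g = gB h -> g = h.
Proof. by case: g h => [? ?] [? ?] /= -> ->. Qed.

HB.instance Definition _ := gen_eqMixin autPair.
HB.instance Definition _ := gen_choiceMixin autPair.

Local Open Scope group_scope.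

Definition autPair_one : autPair := AutPair 1 1.
Definition autPair_mul (g h : autPair) : autPair :=
  let: AutPair A B := g in let: AutPair C D := h in
  AutPair (A * C) (D * C^-1 * B * C).
Definition autPair_inv (g : autPair) : autPair :=
  let: AutPair A B := g in AutPair A^-1 (A * B^-1 * A^-1).

Fact autPair_mulA : associative autPair_mul.
Proof.
move=> [A B] [C D] [E F]; apply: autPair_eq => /=; first exact: mulgA.
by rewrite invgM !mulgA mulgK.
Qed.
Fact autPair_mul1 : left_id autPair_one autPair_mul.
Proof.
by move=> [A B]; apply: autPair_eq; rewrite /= ?mul1g ?mulg1 ?mulgVK.
Qed.
Fact autPair_mulr1 : right_id autPair_one autPair_mul.
Proof. by move=> [A B]; apply: autPair_eq; rewrite /= ?invg1 ?mulg1 ?mul1g. Qed.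
Fact autPair_mulV : left_inverse autPair_one autPair_inv autPair_mul.
Proof.
move=> [A B]; apply: autPair_eq; first exact: mulVg.
by rewrite /= !mulgA !mulgVK mulgV.
Qed.
Fact autPair_mulrV : right_inverse autPair_one autPair_inv autPair_mul.
Proof.
move=> [A B]; apply: autPair_eq; first exact: mulgV.
by rewrite /= invgK !mulgVK mulgV.
Qed.

HB.instance Definition _ := isGroup.Build autPair
  autPair_mulA autPair_mul1 autPair_mulr1 autPair_mulV autPair_mulrV.

End HopfAut.

Section YetterDrinfeld.
Variables (k : fieldType) (H : homHopf k).
Implicit Types A B C D : hopfAut H.

(* The data underlying a Yetter-Drinfeld Hom-module, without its axioms. *)
Record ydData := YDData {
  yd_car :> lmodType k;
  yd_mu : linAut yd_car;
  yd_act : H -> yd_car -> yd_car;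
  yd_coact : yd_car -> tensor yd_car H
}.

Record is_homModule (M : ydData) : Prop := {
  hommod_bilin : bilinear_for *:%R *:%R (@yd_act M);
  hommod_actA : forall a b (m : M),
    yd_act (halpha a) (yd_act b m) = yd_act (hmul a b) (yd_mu M m);
  hommod_mu : forall a (m : M),
    yd_mu M (yd_act a m) = yd_act (halpha a) (yd_mu M m);
  hommod_act1 : forall m : M, yd_act hone m = yd_mu M m
}.

(* (M ⊗ H) ⊗ H and M ⊗ (H ⊗ H) are identified in the usual way. *)
Record is_homComodule (M : ydData) : Prop := {
  homcomod_linear : linear (@yd_coact M);
  homcomod_coactA : forall m : M,
    \sw_(m0, m1 <- yd_coact m) autV (yd_mu M) m0 ⊗ hDelta m1 =
    \sw_(m0, m1 <- yd_coact m) \sw_(m00, m01 <- yd_coact m0)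
      m00 ⊗ (m01 ⊗ autV halpha m1);
  homcomod_mu : forall m : M,
    yd_coact (yd_mu M m) = \sw_(m0, m1 <- yd_coact m) yd_mu M m0 ⊗ halpha m1;
  homcomod_counit : forall m : M,
    \sw_(m0, m1 <- yd_coact m) heps m1 *: m0 = autV (yd_mu M) m
}.

Record is_YD A B (M : ydData) : Prop := {
  yd_module : is_homModule M;
  yd_comodule : is_homComodule M;
  yd_compat : forall h (m : M),
    yd_coact (yd_act h m) =
    \sw_(h1, h2 <- hDelta h) \sw_(h21, h22 <- hDelta h2)
      \sw_(m0, m1 <- yd_coact m)
        yd_act (halpha h21) m0 ⊗
          hmul (hmul (B h22) (autV halpha m1)) (A (inverse_map (hS H) h1))
}.

Record is_ydHom (M N : ydData) (f : M -> N) : Prop := {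
  ydhom_linear : linear f;
  ydhom_mu : forall m, f (yd_mu M m) = yd_mu N (f m);
  ydhom_act : forall h m, f (yd_act h m) = yd_act h (f m);
  ydhom_coact : forall m,
    yd_coact (f m) = \sw_(m0, m1 <- yd_coact m) f m0 ⊗ m1
}.

(* M ⊗ N, for M of degree (A, B) and N of degree (C, D). *)
Definition yd_tensor B C (M N : ydData) : ydData := {|
  yd_car := tensor M N;
  yd_mu := tmap_aut (yd_mu M) (yd_mu N);
  yd_act := fun h x => \sw_(h1, h2 <- hDelta h)
    \sw_(m, n <- x) yd_act (C h1) m ⊗ yd_act ((C^-1 * B * C)%g h2) n;
  yd_coact := fun x => \sw_(m, n <- x)
    \sw_(m0, m1 <- yd_coact m) \sw_(n0, n1 <- yd_coact n)
      (m0 ⊗ n0) ⊗ hmul n1 m1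
|}.

Definition yd_unit : ydData := {|
  yd_car := k^o;
  yd_mu := aut_id k^o;
  yd_act := fun h x => heps h *: x;
  yd_coact := fun x => x ⊗ hone
|}.

(* The conjugate of N by (A, B), for N of degree (C, D). *)
Definition yd_conj A B C (N : ydData) : ydData := {|
  yd_car := N;
  yd_mu := yd_mu N;
  yd_act := fun h n => yd_act ((C^-1 * B * C * A^-1)%g h) n;
  yd_coact := fun n => \sw_(n0, n1 <- yd_coact n) n0 ⊗ (A * B^-1)%g n1
|}.

Definition yd_assoc (M N P : ydData) (x : tensor (tensor M N) P) :
    tensor M (tensor N P) :=
  \sw_(y, p <- x) \sw_(m, n <- y) yd_mu M m ⊗ (n ⊗ autV (yd_mu P) p).

Definition yd_lunit (M : ydData) (x : tensor k^o M) : M :=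
  sweedler (fun (c : k^o) m => c *: yd_mu M m) x.

Definition yd_runit (M : ydData) (x : tensor M k^o) : M :=
  sweedler (fun m (c : k^o) => c *: yd_mu M m) x.

(* c_{M,N}, for M of degree (A, B). *)
Definition yd_braid B (M N : ydData) (x : tensor M N) : tensor N M :=
  \sw_(m, n <- x) \sw_(n0, n1 <- yd_coact n)
    yd_mu N n0 ⊗ yd_act (B^-1%g n1) (autV (yd_mu M) m).

End YetterDrinfeld.

Record category := Category {
  ob :> Type;
  hom : ob -> ob -> Type;
  idc : forall x, hom x x;
  comp : forall x y z, hom y z -> hom x y -> hom x z;
  comp_idl : forall x y (f : hom x y), comp (idc y) f = f;
  comp_idr : forall x y (f : hom x y), comp f (idc x) = f;
  comp_assoc : forall w x y z (h : hom y z) (g : hom x y) (f : hom w x),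
    comp h (comp g f) = comp (comp h g) f
}.

Arguments hom {c}.
Arguments idc {c}.
Notation "g ∘ f" := (comp g f) (at level 40, left associativity).

(* Strict tensor functors, functor equalities and the axioms of a braiding
   compare morphisms whose sources and targets are equal but not convertible;
   such morphisms are compared as elements of [arrow C]. *)
Record arrow (C : category) := Arrow {
  source : C;
  target : C;
  morphism : hom source target
}.
Notation "f ≡ g" := (Arrow f = Arrow g) (at level 70).

Section Categories.
Variable C : category.

Definition inverses (x y : C) (f : hom x y) (g : hom y x) : Prop :=
  g ∘ f = idc x /\ f ∘ g = idc y.

Definition is_iso (x y : C) (f : hom x y) : Prop := exists g, inverses f g.

Definition inv_hom (x y : C) (f : hom x y) (fiso : is_iso f) : hom y x :=
  sval (cid fiso).

Record functor := Functor {
  fob :> C -> C;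
  fmor : forall x y, hom x y -> hom (fob x) (fob y);
  fmor_id : forall x, fmor (idc x) = idc (fob x);
  fmor_comp : forall x y z (g : hom y z) (f : hom x y),
    fmor (g ∘ f) = fmor g ∘ fmor f
}.

Definition eq_functor (F G : functor) : Prop :=
  (forall x, F x = G x) /\
  (forall x y (f : hom x y), fmor F f ≡ fmor G f).

Definition functor_id : functor :=
  @Functor id (fun _ _ f => f) (fun _ => erefl) (fun _ _ _ _ _ => erefl).

Definition functor_comp (G F : functor) : functor.
Proof.
apply: (@Functor (fun x => G (F x)) (fun _ _ f => fmor G (fmor F f))).
- by move=> x; rewrite !fmor_id.
- by move=> x y z g f; rewrite !fmor_comp.
Defined.

Definition invertible (F : functor) : Prop :=
  exists F', eq_functor (functor_comp F F') functor_id /\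
             eq_functor (functor_comp F' F) functor_id.

Record tensorData := TensorData {
  tob : C -> C -> C;
  tmor : forall x y x' y', hom x x' -> hom y y' -> hom (tob x y) (tob x' y');
  tunit : C;
  tassoc : forall x y z, hom (tob (tob x y) z) (tob x (tob y z));
  tlunit : forall x, hom (tob tunit x) x;
  trunit : forall x, hom (tob x tunit) x
}.

Section Monoidal.
Variable T : tensorData.

Local Notation "x ⊠ y" := (tob T x y) (at level 40, left associativity).
Local Notation "f ⊠m g" := (tmor T f g) (at level 40, left associativity).

Record is_monoidal : Prop := {
  tmor_id : forall x y : C, idc x ⊠m idc y = idc (x ⊠ y);
  tmor_comp : forall (x x' x'' y y' y'' : C)
      (f' : hom x' x'') (f : hom x x') (g' : hom y' y'') (g : hom y y'),
    (f' ∘ f) ⊠m (g' ∘ g) = (f' ⊠m g') ∘ (f ⊠m g);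
  tassoc_nat : forall (x x' y y' z z' : C)
      (f : hom x x') (g : hom y y') (h : hom z z'),
    (f ⊠m (g ⊠m h)) ∘ tassoc T x y z = tassoc T x' y' z' ∘ (f ⊠m g ⊠m h);
  tlunit_nat : forall (x x' : C) (f : hom x x'),
    f ∘ tlunit T x = tlunit T x' ∘ (idc (tunit T) ⊠m f);
  trunit_nat : forall (x x' : C) (f : hom x x'),
    f ∘ trunit T x = trunit T x' ∘ (f ⊠m idc (tunit T));
  tassoc_iso : forall x y z : C, is_iso (tassoc T x y z);
  tlunit_iso : forall x : C, is_iso (tlunit T x);
  trunit_iso : forall x : C, is_iso (trunit T x);
  tpentagon : forall w x y z : C,
    tassoc T w x (y ⊠ z) ∘ tassoc T (w ⊠ x) y z =
    (idc w ⊠m tassoc T x y z) ∘ tassoc T w (x ⊠ y) z ∘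
      (tassoc T w x y ⊠m idc z);
  ttriangle : forall x y : C,
    (idc x ⊠m tlunit T y) ∘ tassoc T x (tunit T) y = trunit T x ⊠m idc y
}.

Record is_strict_tensor (F : functor) : Prop := {
  strict_tob : forall x y : C, F (x ⊠ y) = F x ⊠ F y;
  strict_tmor : forall (x y x' y' : C) (f : hom x x') (g : hom y y'),
    fmor F (f ⊠m g) ≡ fmor F f ⊠m fmor F g;
  strict_tunit : F (tunit T) = tunit T;
  strict_tassoc : forall x y z : C,
    fmor F (tassoc T x y z) ≡ tassoc T (F x) (F y) (F z);
  strict_tlunit : forall x : C, fmor F (tlunit T x) ≡ tlunit T (F x);
  strict_trunit : forall x : C, fmor F (trunit T x) ≡ trunit T (F x)
}.

End Monoidal.
End Categories.

(* [deg X] is the index of the subcategory containing the object X. *)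
Record tcatData (G : groupType) := TcatData {
  tcat :> category;
  tdata : tensorData tcat;
  deg : tcat -> G;
  conj : G -> functor tcat;
  braid : forall x y : tcat,
    hom (tob tdata x y) (tob tdata (conj (deg x) y) x)
}.

Section TCategory.
Variables (G : groupType) (C : tcatData G).

Local Notation "x ⊠ y" := (tob (tdata C) x y) (at level 40, left associativity).
Local Notation "f ⊠m g" := (tmor (tdata C) f g) (at level 40, left associativity).
Local Notation a := (tassoc (tdata C)).
Local Notation φ := (conj C).
Local Notation c := (braid (t := C)).
Local Open Scope group_scope.

Record is_crossed : Prop := {
  crossed_monoidal : is_monoidal (tdata C);
  crossed_hom_deg : forall x y : C, hom x y -> deg x = deg y;
  crossed_deg_tensor : forall x y : C, deg (x ⊠ y) = deg x * deg y;
  crossed_strict : forall b, is_strict_tensor (tdata C) (φ b);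
  crossed_invertible : forall b, invertible (φ b);
  crossed_conjM : forall b b',
    eq_functor (φ (b * b')) (functor_comp (φ b) (φ b'));
  (* φ_b(C_g) = C_{b g b^-1}, for objects and for morphisms *)
  crossed_conj_ob : forall b g (y : C),
    deg y = b * g * b^-1 <-> exists2 x : C, deg x = g & φ b x = y;
  crossed_conj_mor : forall b g (y y' : C) (f : hom y y'),
    deg y = b * g * b^-1 <->
    exists x x' (f0 : hom x x'), deg x = g /\ fmor (φ b) f0 ≡ f
}.

(* In the first hexagon the last associator is taken at φ_x (φ_y z), which is
   the same object as φ_{x ⊠ y} z. *)
Record is_braiding (mon : is_monoidal (tdata C)) : Prop := {
  braid_iso : forall x y : C, is_iso (c x y);
  braid_nat : forall (x x' y y' : C) (f : hom x x') (g : hom y y'),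
    (fmor (φ (deg x)) g ⊠m f) ∘ c x y ≡ c x' y' ∘ (f ⊠m g);
  braid_hexagon1 : forall x y z : C,
    c (x ⊠ y) z ≡
    a (φ (deg x) (φ (deg y) z)) x y ∘ (c x (φ (deg y) z) ⊠m idc y) ∘
      inv_hom (tassoc_iso mon x (φ (deg y) z) y) ∘ (idc x ⊠m c y z) ∘ a x y z;
  braid_hexagon2 : forall x y z : C,
    c x (y ⊠ z) ≡
    inv_hom (tassoc_iso mon (φ (deg x) y) (φ (deg x) z) x) ∘
      (idc (φ (deg x) y) ⊠m c x z) ∘ a (φ (deg x) y) x z ∘
      (c x y ⊠m idc z) ∘ inv_hom (tassoc_iso mon x y z);
  braid_conj : forall b (x y : C),
    fmor (φ b) (c x y) ≡ c (φ b x) (φ b y)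
}.

Definition is_braided_Tcategory : Prop :=
  exists cr : is_crossed, is_braiding (crossed_monoidal cr).

End TCategory.

Section MHYD.
Variables (k : fieldType) (H : homHopf k).

(* The disjoint union over (A, B) of the categories HMHYD^H(A, B): there is no
   morphism between objects of different components. *)
Record mhydOb := MhydOb {
  mhyd_deg : autPair H;
  mhyd_obj :> ydData H;
  mhyd_YD : is_YD (gA mhyd_deg) (gB mhyd_deg) mhyd_obj
}.

Record mhydHom (M N : mhydOb) := MhydHom {
  mhyd_fun :> M -> N;
  mhyd_same_deg : mhyd_deg M = mhyd_deg N;
  mhyd_ydHom : is_ydHom mhyd_fun
}.

Lemma mhydHom_eq (M N : mhydOb) (f g : mhydHom M N) :
  mhyd_fun f =1 mhyd_fun g -> f = g.
Proof.
case: f g => [f df hf] [g dg hg] /= /funext fg; subst g.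
by congr MhydHom; apply: Prop_irrelevance.
Qed.

Definition mhyd_id (M : mhydOb) : mhydHom M M.
Proof.
apply: (@MhydHom _ _ id erefl); split=> // m.
by rewrite -[RHS]/(tmap id id (yd_coact m)) tmap_id.
Defined.

Definition mhyd_comp (M N P : mhydOb) (g : mhydHom N P) (f : mhydHom M N) :
  mhydHom M P.
Proof.
apply: (@MhydHom _ _ (fun m => g (f m))).
  by rewrite (mhyd_same_deg f) (mhyd_same_deg g).
have [fl fmu fa fc] := mhyd_ydHom f; have [gl gmu ga gc] := mhyd_ydHom g.
split=> [|m|h m|m]; first exact: comp_linear.
- by rewrite fmu gmu.
- by rewrite fa ga.
- rewrite gc fc -[in LHS]/(tmap f id (yd_coact m)).
  by rewrite -[LHS]/(tmap g id _) tmap_comp.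
Defined.

Definition mhydCat : category.
Proof.
by apply: (@Category mhydOb mhydHom mhyd_id mhyd_comp) => *; apply: mhydHom_eq.
Defined.

(* The action and coaction of the tensor product, unit and conjugation define
   objects of the expected components. *)
Record mhyd_ob_closed : Prop := {
  closed_tensor : forall M N : mhydOb,
    is_YD (gA (mhyd_deg M * mhyd_deg N)%g) (gB (mhyd_deg M * mhyd_deg N)%g)
      (yd_tensor (gB (mhyd_deg M)) (gA (mhyd_deg N)) M N);
  closed_unit : is_YD 1%g 1%g (yd_unit H);
  closed_conj : forall (b : autPair H) (N : mhydOb),
    is_YD (gA (b * mhyd_deg N * b^-1)%g) (gB (b * mhyd_deg N * b^-1)%g)
      (yd_conj (gA b) (gB b) (gA (mhyd_deg N)) N)
}.

Section Structure.
Variable wo : mhyd_ob_closed.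

Definition mhyd_tensor (M N : mhydOb) : mhydOb := MhydOb (closed_tensor wo M N).
Definition mhyd_unit : mhydOb := @MhydOb 1%g (yd_unit H) (closed_unit wo).
Definition mhyd_conj (b : autPair H) (N : mhydOb) : mhydOb :=
  MhydOb (closed_conj wo b N).

Local Notation "M ⊠ N" := (mhyd_tensor M N) (at level 40, left associativity).
Local Notation yd_hom M N f := (@is_ydHom k H M N f).

(* The structure maps are H-linear and H-colinear. *)
Record mhyd_hom_closed : Prop := {
  closed_tmap : forall (M N M' N' : mhydOb) (f : mhydHom M M') (g : mhydHom N N'),
    yd_hom (M ⊠ N) (M' ⊠ N') (tmap f g);
  closed_assoc : forall M N P : mhydOb,
    yd_hom (M ⊠ N ⊠ P) (M ⊠ (N ⊠ P)) (@yd_assoc k H M N P);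
  closed_lunit : forall M : mhydOb,
    yd_hom (mhyd_unit ⊠ M) M (@yd_lunit k H M);
  closed_runit : forall M : mhydOb,
    yd_hom (M ⊠ mhyd_unit) M (@yd_runit k H M);
  closed_conj_mor : forall (b : autPair H) (N N' : mhydOb) (f : mhydHom N N'),
    yd_hom (mhyd_conj b N) (mhyd_conj b N') f;
  closed_braid : forall M N : mhydOb,
    yd_hom (M ⊠ N) (mhyd_conj (mhyd_deg M) N ⊠ M)
      (@yd_braid k H (gB (mhyd_deg M)) M N)
}.

Variable wh : mhyd_hom_closed.

Definition mhyd_tmap (M N M' N' : mhydOb) (f : mhydHom M M')
    (g : mhydHom N N') : mhydHom (M ⊠ N) (M' ⊠ N').
Proof.
apply: (MhydHom _ (closed_tmap wh f g)).
by rewrite /= (mhyd_same_deg f) (mhyd_same_deg g).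
Defined.

Definition mhyd_assoc (M N P : mhydOb) : mhydHom (M ⊠ N ⊠ P) (M ⊠ (N ⊠ P)) :=
  @MhydHom (M ⊠ N ⊠ P) (M ⊠ (N ⊠ P)) _ (esym (mulgA _ _ _)) (closed_assoc wh M N P).

Definition mhyd_lunit (M : mhydOb) : mhydHom (mhyd_unit ⊠ M) M :=
  @MhydHom (mhyd_unit ⊠ M) M _ (mul1g _) (closed_lunit wh M).

Definition mhyd_runit (M : mhydOb) : mhydHom (M ⊠ mhyd_unit) M :=
  @MhydHom (M ⊠ mhyd_unit) M _ (mulg1 _) (closed_runit wh M).

Definition mhyd_tensorData : tensorData mhydCat :=
  @TensorData mhydCat mhyd_tensor mhyd_tmap mhyd_unit
    mhyd_assoc mhyd_lunit mhyd_runit.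

Definition mhyd_conj_mor (b : autPair H) (N N' : mhydOb) (f : mhydHom N N') :
  mhydHom (mhyd_conj b N) (mhyd_conj b N').
Proof.
apply: (MhydHom _ (closed_conj_mor wh b f)).
by rewrite /= (mhyd_same_deg f).
Defined.

Definition mhyd_conj_functor (b : autPair H) : functor mhydCat.
Proof.
by apply: (@Functor mhydCat (mhyd_conj b) (mhyd_conj_mor b)) => *;
  apply: mhydHom_eq.
Defined.

Definition mhyd_braid (M N : mhydOb) :
  mhydHom (M ⊠ N) (mhyd_conj (mhyd_deg M) N ⊠ M).
Proof.
by apply: (MhydHom _ (closed_braid wh M N)); rewrite /= mulgVK.
Defined.

Definition MHYD : tcatData (autPair H) :=
  @TcatData _ mhydCat mhyd_tensorData mhyd_deg mhyd_conj_functor mhyd_braid.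

End Structure.

End MHYD.

(* Main.v *)
Require Import Defs.
From mathcomp Require Import all_boot all_algebra.
From mathcomp Require Import boolp.

Set Implicit Arguments.
Unset Strict Implicit.
Unset Printing Implicit Defensive.

Import GRing.Theory.
Local Open Scope ring_scope.

(** MHYD(H) is a braided T-category for the same reason as its classical
    counterpart: over an ordinary Hopf algebra, each axiom is an identity between
    iterated Sweedler sums in which, after coassociativity has been used, either
    the two sides agree or one side contains a factor S^-1(h2) h1 that collapses
    to a counit.  In the Hom setting the structure maps [alpha] and [mu] have to
    be carried along.  They are automorphisms of all the structure, so that they
    can be pushed to the leaves of every expression, where they can be compared.

    The proof therefore rests on a normal form for Sweedler sums.  All coproducts
    and coactions are expanded and nested to the right, all products are
    parenthesised to the right, every module element carries a single action, and
    all automorphisms sit at the leaves; two sums are then compared up to a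
    permutation of independent summations.  The tactic [sw_eq] does this.  It
    proves what follows from associativity, coassociativity, the Yetter-Drinfeld
    condition and the compatibility of all operations with the automorphisms.

    The antipode is what remains.  It is antimultiplicative ([ant_mulh], by
    computing one convolution product in two ways), hence so is its inverse, which
    gives the cancellation S^-1(h2) h1 = eps(h) 1 inside a longer coproduct
    ([sw_antV_cancel]).  That cancellation is used three times: for the
    Yetter-Drinfeld condition on a tensor product ([tensor_compat]) and for the
    linearity and colinearity of the braiding ([braid_actm], [braid_coac]).  The
    twists by automorphisms of H match because the group law of G was chosen so
    that they do.  The inverse of the braiding is
    n ⊗ m |-> B^-1(S(n_1)).mu^-1(m) ⊗ nu(n_0).

    The axioms of a T-category also compare morphisms between objects that are
    equal but not convertible, such as phi_b (M ⊗ N) and phi_b M ⊗ phi_b N.  Such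
    objects have convertible underlying spaces, so by [agree_eq] and [arrow_eq] it
    is enough to compare degrees, operations and functions on that space. *)

(** * Multilinear maps and Sweedler sums *)

Section Multilinear.
Variable k : fieldType.
Implicit Types U V W X Y : lmodType k.

(** A constant standing for linearity, so that proof search by head symbol sees
    an atomic goal and not a quantified equation. *)
Definition islin U V (f : U -> V) : Prop := linear f.

Definition bilin U V W (b : U -> V -> W) : Prop :=
  (forall v, islin (fun u => b u v)) /\ (forall u, islin (fun v => b u v)).

Definition trilin U V W X (b : U -> V -> W -> X) : Prop :=
  [/\ forall v w, islin (fun u => b u v w), forall u w, islin (fun v => b u v w)
    & forall u v, islin (fun w => b u v w)].

Lemma bilinE U V W (b : U -> V -> W) : bilin b -> bilinear_for *:%R *:%R b.
Proof. by case=> bl br; split=> [v|u]; [apply: bl|apply: br]. Qed.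

Lemma bilinP U V W (b : U -> V -> W) : bilinear_for *:%R *:%R b -> bilin b.
Proof. by case=> bl br; split=> [v|u]; [apply: bl|apply: br]. Qed.

Lemma lin_id U : islin (fun u : U => u).
Proof. by []. Qed.

Lemma lin_eta U V (f : U -> V) : islin (fun x => f x) -> islin f.
Proof. by []. Qed.

Lemma lin_comp U V W (g : V -> W) (f : U -> V) :
  islin g -> islin f -> islin (fun x => g (f x)).
Proof. exact: comp_linear. Qed.

Lemma lin_aut U V (g : linAut V) (f : U -> V) :
  islin f -> islin (fun x => g (f x)).
Proof. exact: comp_linear (aut_linear g). Qed.

Lemma lin_autV U V (g : linAut V) (f : U -> V) :
  islin f -> islin (fun x => autV g (f x)).
Proof. exact: comp_linear (@autV_linear _ _ g). Qed.

Lemma lin_linear U V W (g : {linear V -> W}) (f : U -> V) :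
  islin f -> islin (fun x => g (f x)).
Proof. by apply: comp_linear => c x y; rewrite linearP. Qed.

Lemma lin_bilinl U V V' W (b : V -> V' -> W) (f : U -> V) v :
  bilin b -> islin f -> islin (fun x => b (f x) v).
Proof. by case=> bl _; apply: comp_linear (bl v). Qed.

Lemma lin_bilinr U V V' W (b : V -> V' -> W) (f : U -> V') v :
  bilin b -> islin f -> islin (fun x => b v (f x)).
Proof. by case=> _ br; apply: comp_linear (br v). Qed.

Lemma lin_trilin1 U V V' W X (b : V -> V' -> W -> X) (f : U -> V) v w :
  trilin b -> islin f -> islin (fun x => b (f x) v w).
Proof. by case=> b1 _ _; apply: comp_linear (b1 v w). Qed.

Lemma lin_trilin2 U V V' W X (b : V -> V' -> W -> X) (f : U -> V') v w :
  trilin b -> islin f -> islin (fun x => b v (f x) w).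
Proof. by case=> _ b2 _; apply: comp_linear (b2 v w). Qed.

Lemma lin_trilin3 U V V' W X (b : V -> V' -> W -> X) (f : U -> W) v w :
  trilin b -> islin f -> islin (fun x => b v w (f x)).
Proof. by case=> _ _ b3; apply: comp_linear (b3 v w). Qed.

Lemma bilin_tens U V : bilin (@tens k U V).
Proof. exact/bilinP/tens_is_bilinear. Qed.

Lemma bilin_mul U V W (b : {bilinear U -> V -> W}) : bilin b.
Proof. by split=> [v|u] c x y; rewrite ?linearPl ?linearPr. Qed.

Lemma bilin_scale U : bilin (fun (c : k^o) (u : U) => c *: u).
Proof.
split=> [v|u] c x y; first by rewrite scalerDl scalerA.
by rewrite scalerDr !scalerA mulrC.
Qed.

(** A variable of a Sweedler sum occurs either in the tensor that is decomposed,
    where bilinearity of the summand makes the sum well defined on classes, or in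
    the summand, where the sum is a finite sum of linear maps. *)
Lemma lin_sw_arg U V W X (b : V -> W -> X) (f : U -> tensor V W) :
  bilin b -> islin f -> islin (fun x => sweedler b (f x)).
Proof. by move/bilinE/sweedler_is_linear; apply: comp_linear. Qed.

Lemma lin_sw_body U V W X (b : U -> V -> W -> X) (t : tensor V W) :
  (forall v w, islin (fun x => b x v w)) -> islin (fun x => sweedler (b x) t).
Proof.
move=> hb c x y; rewrite /sweedler /fs_eval scaler_sumr -big_split.
by apply: eq_bigr => p _; apply: hb.
Qed.

Lemma eq_sw U V W (b b' : U -> V -> W) (t : tensor U V) :
  (forall u v, b u v = b' u v) -> sweedler b t = sweedler b' t.
Proof. by move=> e; apply: eq_bigr => p _; apply: e. Qed.

Lemma sw_tens U V W (b : U -> V -> W) u v :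
  bilin b -> sweedler b (u ⊗ v) = b u v.
Proof. by move=> hb; apply/sweedler_tens/bilinE. Qed.

Lemma lin_sum U V (f : U -> V) I (r : seq I) (F : I -> U) :
  islin f -> f (\sum_(i <- r) F i) = \sum_(i <- r) f (F i).
Proof.
move=> hf; elim: r => [|i r IHr]; first by rewrite !big_nil linear_0.
by rewrite !big_cons linear_D // IHr.
Qed.

Lemma lin_sw U V W X (f : W -> X) (b : U -> V -> W) t :
  islin f -> f (sweedler b t) = sweedler (fun u v => f (b u v)) t.
Proof. exact: lin_sum. Qed.

Lemma sw_sw U V U' V' W (b : U -> V -> W) (b' : U' -> V' -> tensor U V) t :
  bilin b ->
  sweedler b (sweedler b' t) = sweedler (fun u v => sweedler b (b' u v)) t.
Proof.
by move=> hb; apply: (lin_sw (f := sweedler b)); apply/sweedler_is_linear/bilinE.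
Qed.

(** Both sides are the double sum over the representatives chosen for [t] and
    [t'], whatever [b] is. *)
Lemma sw_exchange U V U' V' W (b : U -> V -> U' -> V' -> W) t t' :
  sweedler (fun u v => sweedler (b u v) t') t =
  sweedler (fun u' v' => sweedler (fun u v => b u v u' v') t) t'.
Proof. exact: exchange_big. Qed.

Lemma sw_eta U V (t : tensor U V) : \sw_(u, v <- t) u ⊗ v = t.
Proof. exact: (@tmap_id k U V id id). Qed.

Lemma tensor_lin_ext U V W (f g : tensor U V -> W) : islin f -> islin g ->
  (forall u v, f (u ⊗ v) = g (u ⊗ v)) -> f =1 g.
Proof. exact: tensor_ext. Qed.

End Multilinear.

Arguments lin_bilinl {k U V V' W b f v}.
Arguments lin_bilinr {k U V V' W b f v}.
Arguments lin_trilin1 {k U V V' W X b f v w}.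
Arguments lin_trilin2 {k U V V' W X b f v w}.
Arguments lin_trilin3 {k U V V' W X b f v w}.
Arguments lin_comp {k U V W g f}.

(** * The operations of H and of its Yetter-Drinfeld modules *)

(** Each operation gets a constant whose only arguments are the Hopf algebra or
    the module and the operands.  Linearity and rewriting rules are then selected
    by that constant, without unfolding the bundled structures. *)
Section Operations.
Variables (k : fieldType) (H : homHopf k).
Implicit Types (M N : mhydOb H) (A B : hopfAut H) (U V X : lmodType k).

Definition mulh (x y : H) : H := hmul x y.
Definition oneh : H := hone.
Definition cop (x : H) : tensor H H := hDelta x.
(** The counit only ever occurs as a scalar acting on the rest of the term. *)
Definition epsz U (x : H) (u : U) : U := heps x *: u.
Definition sc U (c : k^o) (u : U) : U := c *: u.
Definition al (x : H) : H := halpha x.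
Definition alV (x : H) : H := autV halpha x.
Definition ant (x : H) : H := hS H x.
Definition antV (x : H) : H := inverse_map (hS H) x.
Definition hau A (x : H) : H := A x.
Definition hauV A (x : H) : H := A^-1%g x.
Definition mum M (m : M) : M := yd_mu M m.
Definition mumV M (m : M) : M := autV (yd_mu M) m.
Definition actm M (h : H) (m : M) : M := yd_act h m.
Definition coac M (m : M) : tensor M H := yd_coact m.

Lemma bilin_mulh : bilin mulh.
Proof. exact: bilin_mul. Qed.
Lemma bilin_actm M : bilin (@actm M).
Proof. exact/bilinP/(hommod_bilin (yd_module (mhyd_YD M))). Qed.
Lemma bilin_epsz U : bilin (@epsz U).
Proof.
split=> [v|u] c x y; rewrite /epsz; first by rewrite linearP scalerDl scalerA.
by rewrite scalerDr !scalerA mulrC.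
Qed.

Lemma lin_tensl X U V (f : X -> U) (v : V) : islin f -> islin (fun x => f x ⊗ v).
Proof. exact/lin_bilinl/bilin_tens. Qed.
Lemma lin_tensr X U V (f : X -> V) (u : U) : islin f -> islin (fun x => u ⊗ f x).
Proof. exact/lin_bilinr/bilin_tens. Qed.
Lemma lin_mulhl X (f : X -> H) h : islin f -> islin (fun x => mulh (f x) h).
Proof. exact/lin_bilinl/bilin_mulh. Qed.
Lemma lin_mulhr X (f : X -> H) h : islin f -> islin (fun x => mulh h (f x)).
Proof. exact/lin_bilinr/bilin_mulh. Qed.
Lemma lin_actml X M (f : X -> H) (m : M) : islin f -> islin (fun x => actm (f x) m).
Proof. exact/lin_bilinl/bilin_actm. Qed.
Lemma lin_actmr X M (f : X -> M) h : islin f -> islin (fun x => actm h (f x)).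
Proof. exact/lin_bilinr/bilin_actm. Qed.
Lemma lin_epszl X U (f : X -> H) (u : U) : islin f -> islin (fun x => epsz (f x) u).
Proof. exact/lin_bilinl/bilin_epsz. Qed.
Lemma lin_epszr X U (f : X -> U) h : islin f -> islin (fun x => epsz h (f x)).
Proof. exact/lin_bilinr/bilin_epsz. Qed.

Lemma lin_scl X U (f : X -> k^o) (u : U) : islin f -> islin (fun x => sc (f x) u).
Proof. exact/(lin_bilinl (b := @sc U))/bilin_scale. Qed.
Lemma lin_scr X U (f : X -> U) c : islin f -> islin (fun x => sc c (f x)).
Proof. exact/(lin_bilinr (b := @sc U))/bilin_scale. Qed.

Lemma lin_al X (f : X -> H) : islin f -> islin (fun x => al (f x)).
Proof. exact: lin_aut. Qed.
Lemma lin_alV X (f : X -> H) : islin f -> islin (fun x => alV (f x)).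
Proof. exact: lin_autV. Qed.
Lemma lin_hau X A (f : X -> H) : islin f -> islin (fun x => hau A (f x)).
Proof. exact: lin_aut. Qed.
Lemma lin_hauV X A (f : X -> H) : islin f -> islin (fun x => hauV A (f x)).
Proof. exact: lin_autV. Qed.
Lemma lin_mum X M (f : X -> M) : islin f -> islin (fun x => mum (f x)).
Proof. exact: lin_aut. Qed.
Lemma lin_mumV X M (f : X -> M) : islin f -> islin (fun x => mumV (f x)).
Proof. exact: lin_autV. Qed.
Lemma lin_cop X (f : X -> H) : islin f -> islin (fun x => cop (f x)).
Proof. exact: lin_linear. Qed.
Lemma lin_ant X (f : X -> H) : islin f -> islin (fun x => ant (f x)).
Proof. exact: lin_linear. Qed.
Lemma lin_coac X M (f : X -> M) : islin f -> islin (fun x => coac (f x)).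
Proof. exact: comp_linear (homcomod_linear (yd_comodule (mhyd_YD M))). Qed.
Lemma lin_mhyd X M N (g : mhydHom M N) (f : X -> M) :
  islin f -> islin (fun x => g (f x)).
Proof. exact: comp_linear (ydhom_linear (mhyd_ydHom g)). Qed.

Hypothesis S_bij : bijective (hS H).

Lemma antVK x : antV (ant x) = x.
Proof. exact: inverse_mapK. Qed.
Lemma antKV x : ant (antV x) = x.
Proof. exact: inverse_mapVK. Qed.
Lemma lin_antV X (f : X -> H) : islin f -> islin (fun x => antV (f x)).
Proof.
apply: comp_linear => c x y; apply: (bij_inj S_bij).
by rewrite linearP -!/(ant _) !antKV.
Qed.
End Operations.

(** [lin] proves linearity, bilinearity and trilinearity.  In a multilinear
    expression each variable occurs exactly once, so at each node only the lemma for
    the argument that contains the variable unifies.  Modules are passed explicitly,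
    because the space of a tensor product of modules may be given in unfolded
    form. *)
Ltac lin_rec :=
  cbv beta;
  lazymatch goal with
  | |- trilin _ => split; intros; lin_rec
  | |- bilin _ => split; intro; lin_rec
  | |- islin (fun x => x) => exact: lin_id
  | |- islin (fun x => sweedler _ _) =>
      first [ simple apply lin_sw_body; intros; lin_rec
            | simple apply lin_sw_arg; lin_rec ]
  | |- islin (fun x => @tens _ ?U ?V _ _) =>
      first [ refine (@lin_tensl _ _ U V _ _ _); lin_rec
            | refine (@lin_tensr _ _ U V _ _ _); lin_rec ]
  | |- islin (fun x => mulh _ _) =>
      first [ simple apply lin_mulhl; lin_rec | simple apply lin_mulhr; lin_rec ]
  | |- islin (fun x => @actm _ _ ?M _ _) =>
      first [ refine (@lin_actml _ _ _ M _ _ _); lin_rec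
            | refine (@lin_actmr _ _ _ M _ _ _); lin_rec ]
  | |- islin (fun x => epsz _ _) =>
      first [ simple apply lin_epszl; lin_rec | simple apply lin_epszr; lin_rec ]
  | |- islin (fun x => sc _ _) =>
      first [ simple apply lin_scl; lin_rec | simple apply lin_scr; lin_rec ]
  | |- islin (fun x => al _) => simple apply lin_al; lin_rec
  | |- islin (fun x => alV _) => simple apply lin_alV; lin_rec
  | |- islin (fun x => hau _ _) => simple apply lin_hau; lin_rec
  | |- islin (fun x => hauV _ _) => simple apply lin_hauV; lin_rec
  | |- islin (fun x => @mum _ _ ?M _) => refine (@lin_mum _ _ _ M _ _); lin_rec
  | |- islin (fun x => @mumV _ _ ?M _) => refine (@lin_mumV _ _ _ M _ _); lin_rec
  | |- islin (fun x => cop _) => simple apply lin_cop; lin_rec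
  | |- islin (fun x => @coac _ _ ?M _) => refine (@lin_coac _ _ _ M _ _); lin_rec
  | |- islin (fun x => ant _) => simple apply lin_ant; lin_rec
  | |- islin (fun x => antV _) => simple apply lin_antV; [assumption | lin_rec]
  | |- islin (fun x => mhyd_fun _ _) => simple apply lin_mhyd; lin_rec
  | |- islin (fun x => _) => first [assumption | lin_hyp]
  | |- islin ?f => first [assumption | simple apply lin_eta; lin_rec]
  end
with lin_hyp :=
  match goal with
  | h : islin ?f |- islin (fun x => ?f _) => refine (lin_comp h _); lin_rec
  | h : bilin ?b |- islin (fun x => ?b _ _) =>
      first [ refine (lin_bilinl h _); lin_rec | refine (lin_bilinr h _); lin_rec ]
  | h : trilin ?b |- islin (fun x => ?b _ _ _) =>
      first [ refine (lin_trilin1 h _); lin_rec | refine (lin_trilin2 h _); lin_rec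
            | refine (lin_trilin3 h _); lin_rec ]
  end.

Ltac lin := cbv beta delta [reverse_coercion]; lin_rec.

Section PureTensors.
Variable k : fieldType.
Implicit Types U V W X Y : lmodType k.

(** Equality of linear maps out of iterated tensor products can be tested on pure
    tensors; a factor in [k] can moreover be set to [1]. *)
Lemma tensor3_lin_ext U V W X (f g : tensor (tensor U V) W -> X) :
  islin f -> islin g ->
  (forall u v w, f ((u ⊗ v) ⊗ w) = g ((u ⊗ v) ⊗ w)) -> f =1 g.
Proof.
move=> hf hg fg; apply: tensor_lin_ext => // y w.
move: y; apply: tensor_lin_ext => [||u v]; last exact: fg.
  by refine (lin_comp hf _); lin.
by refine (lin_comp hg _); lin.
Qed.

Lemma tensor4_lin_ext U V W X Y (f g : tensor (tensor (tensor U V) W) X -> Y) :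
  islin f -> islin g ->
  (forall u v w x, f (((u ⊗ v) ⊗ w) ⊗ x) = g (((u ⊗ v) ⊗ w) ⊗ x)) -> f =1 g.
Proof.
move=> hf hg fg; apply: tensor_lin_ext => // y x.
move: y; apply: tensor3_lin_ext => [||u v w]; last exact: fg.
  by refine (lin_comp hf _); lin.
by refine (lin_comp hg _); lin.
Qed.

Lemma lin_unit W (f : k^o -> W) c : islin f -> f c = c *: f 1.
Proof.
move=> hf; have e := hf c 1 0; rewrite !addr0 linear_0 // addr0 in e.
by rewrite -e [_ *: 1]mulr1.
Qed.

Lemma lunit_lin_ext U W (f g : tensor k^o U -> W) :
  islin f -> islin g ->
  (forall u, f (tens (1 : k^o) u) = g (tens (1 : k^o) u)) -> f =1 g.
Proof.
move=> hf hg fg; apply: tensor_lin_ext => // c u.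
rewrite (lin_unit (f := fun c => f (c ⊗ u))); last by refine (lin_comp hf _); lin.
by rewrite fg -(lin_unit (f := fun c => g (c ⊗ u))) //; refine (lin_comp hg _); lin.
Qed.

Lemma runit_lin_ext U W (f g : tensor U k^o -> W) :
  islin f -> islin g ->
  (forall u, f (tens u (1 : k^o)) = g (tens u (1 : k^o))) -> f =1 g.
Proof.
move=> hf hg fg; apply: tensor_lin_ext => // u c.
rewrite (lin_unit (f := fun c => f (u ⊗ c))); last by refine (lin_comp hf _); lin.
by rewrite fg -(lin_unit (f := fun c => g (u ⊗ c))) //; refine (lin_comp hg _); lin.
Qed.

End PureTensors.

(** * Rewriting rules *)

Section Rules.
Variables (k : fieldType) (H : homHopf k).
Implicit Types (M N : mhydOb H) (A B : hopfAut H) (U V W X : lmodType k).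
Implicit Types (x y z : H).

Let alg := hombialg_alg (hopf_bialg H).
Let coalg := hombialg_coalg (hopf_bialg H).

Lemma alVK x : alV (al x) = x. Proof. exact: autK. Qed.
Lemma alKV x : al (alV x) = x. Proof. exact: autVK. Qed.
Lemma mumVK M (m : M) : mumV (mum m) = m. Proof. exact: autK. Qed.
Lemma mumKV M (m : M) : mum (mumV m) = m. Proof. exact: autVK. Qed.
Lemma hauVK A x : hauV A (hau A x) = x. Proof. exact: autK. Qed.
Lemma hauKV A x : hau A (hauV A x) = x. Proof. exact: autVK. Qed.
Lemma hau_mulg A B x : hau (A * B)%g x = hau A (hau B x). Proof. by []. Qed.
Lemma hau_invg A x : hau A^-1%g x = hauV A x. Proof. by []. Qed.
Lemma hau_1g x : hau 1%g x = x. Proof. by []. Qed.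

Lemma hauV_mulg A B x : hauV (A * B)%g x = hauV B (hauV A x). Proof. by []. Qed.
Lemma hauV_invg A x : hauV A^-1%g x = hau A x. Proof. by []. Qed.
Lemma hauV_1g x : hauV 1%g x = x. Proof. by []. Qed.

Lemma al_mulh x y : al (mulh x y) = mulh (al x) (al y).
Proof. exact: homalg_autM alg _ _. Qed.
Lemma alV_mulh x y : alV (mulh x y) = mulh (alV x) (alV y).
Proof. by rewrite -{1}[x]alKV -{1}[y]alKV -al_mulh alVK. Qed.
(** Oriented so that products nest to the right. *)
Lemma mulhA x y z : mulh (mulh x y) z = mulh (al x) (mulh y (alV z)).
Proof. by rewrite -{1}[z]alKV; apply/esym; apply: homalg_mulA alg _ _ _. Qed.
Lemma al_one : al (oneh H) = oneh H. Proof. exact: homalg_aut1 alg. Qed.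
Lemma alV_one : alV (oneh H) = oneh H. Proof. by rewrite -{1}al_one alVK. Qed.
Lemma mul1h x : mulh (oneh H) x = al x. Proof. exact: homalg_mul1r alg _. Qed.
Lemma mulh1 x : mulh x (oneh H) = al x. Proof. exact: homalg_mulr1 alg _. Qed.

Lemma hau_mulh A x y : hau A (mulh x y) = mulh (hau A x) (hau A y).
Proof. exact: hautM. Qed.
Lemma hauV_mulh A x y : hauV A (mulh x y) = mulh (hauV A x) (hauV A y).
Proof. exact: hautM. Qed.
Lemma hau_one A : hau A (oneh H) = oneh H. Proof. exact: haut1. Qed.
Lemma hauV_one A : hauV A (oneh H) = oneh H. Proof. exact: haut1. Qed.
Lemma hau_al A x : hau A (al x) = al (hau A x). Proof. exact: haut_alpha. Qed.
Lemma hauV_al A x : hauV A (al x) = al (hauV A x). Proof. exact: haut_alpha. Qed.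
Lemma hau_alV A x : hau A (alV x) = alV (hau A x).
Proof. by rewrite -{2}[x]alKV hau_al alVK. Qed.
Lemma hauV_alV A x : hauV A (alV x) = alV (hauV A x).
Proof. by rewrite -{2}[x]alKV hauV_al alVK. Qed.

Lemma ant_al x : ant (al x) = al (ant x).
Proof. exact: antipode_aut (hopf_antipode H) _. Qed.
Lemma ant_alV x : ant (alV x) = alV (ant x).
Proof. by rewrite -{2}[x]alKV ant_al alVK. Qed.
Lemma ant_hau A x : ant (hau A x) = hau A (ant x).
Proof. by rewrite -[LHS]/(hS H (A x)) -haut_S. Qed.
Lemma ant_hauV A x : ant (hauV A x) = hauV A (ant x).
Proof. exact: (ant_hau A^-1%g). Qed.

Lemma mum_actm M h (m : M) : mum (actm h m) = actm (al h) (mum m).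
Proof. exact: hommod_mu (yd_module (mhyd_YD M)) _ _. Qed.
Lemma mumV_actm M h (m : M) : mumV (actm h m) = actm (alV h) (mumV m).
Proof. by rewrite -{1}[h]alKV -{1}[m]mumKV -mum_actm mumVK. Qed.
(** Oriented so that each module element carries one action. *)
Lemma actmA M x y (m : M) : actm x (actm y m) = actm (mulh (alV x) y) (mum m).
Proof. by rewrite -{1}[x]alKV; apply: hommod_actA (yd_module (mhyd_YD M)) _ _ _. Qed.
Lemma act1m M (m : M) : actm (oneh H) m = mum m.
Proof. exact: hommod_act1 (yd_module (mhyd_YD M)) _. Qed.

Lemma mhyd_mum M N (f : mhydHom M N) (m : M) : f (mum m) = mum (f m).
Proof. exact: ydhom_mu (mhyd_ydHom f) _. Qed.
Lemma mhyd_mumV M N (f : mhydHom M N) (m : M) : f (mumV m) = mumV (f m).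
Proof. by rewrite -{2}[m]mumKV mhyd_mum mumVK. Qed.
Lemma mhyd_actm M N (f : mhydHom M N) x (m : M) : f (actm x m) = actm x (f m).
Proof. exact: ydhom_act (mhyd_ydHom f) _ _. Qed.

Lemma epsz_al U x (u : U) : epsz (al x) u = epsz x u.
Proof. by rewrite /epsz (homcoalg_auteps coalg). Qed.
Lemma epsz_alV U x (u : U) : epsz (alV x) u = epsz x u.
Proof. by rewrite -epsz_al alKV. Qed.
Lemma epsz_hau U A x (u : U) : epsz (hau A x) u = epsz x u.
Proof. by rewrite /epsz [heps _]haut_eps. Qed.
Lemma epsz_hauV U A x (u : U) : epsz (hauV A x) u = epsz x u.
Proof. exact: (epsz_hau A^-1%g). Qed.
Lemma epsz_mulh U x y (u : U) : epsz (mulh x y) u = epsz x (epsz y u).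
Proof. by rewrite /epsz (hombialg_epsM (hopf_bialg H)) scalerA. Qed.
Lemma epsz_one U (u : U) : epsz (oneh H) u = u.
Proof. by rewrite /epsz (hombialg_eps1 (hopf_bialg H)) scale1r. Qed.
Lemma epsz_lin U V (f : U -> V) x u : islin f -> f (epsz x u) = epsz x (f u).
Proof. by move=> hf; have := hf (heps x) u 0; rewrite !addr0 linear_0 ?addr0. Qed.

Lemma sc1 U (u : U) : sc 1 u = u.
Proof. exact: scale1r. Qed.
Lemma sc_epsz U x (c : k^o) (u : U) : sc (epsz x c) u = epsz x (sc c u).
Proof. by rewrite /sc /epsz scalerA. Qed.

Section Binder.
Variables (W : lmodType k).
Implicit Types (b : H -> H -> W).

Lemma sw_cop_al b x : bilin b ->
  sweedler b (cop (al x)) = \sw_(u, v <- cop x) b (al u) (al v).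
Proof.
move=> hb; rewrite [cop (al x)](homcoalg_autD coalg) sw_sw //.
by apply: eq_sw => u v; rewrite sw_tens.
Qed.

Lemma sw_cop_alV b x : bilin b ->
  sweedler b (cop (alV x)) = \sw_(u, v <- cop x) b (alV u) (alV v).
Proof.
move=> hb; rewrite -{2}[x]alKV sw_cop_al; last by lin.
by apply: eq_sw => u v; rewrite !alVK.
Qed.

Lemma sw_cop_hau b A x : bilin b ->
  sweedler b (cop (hau A x)) = \sw_(u, v <- cop x) b (hau A u) (hau A v).
Proof.
move=> hb; rewrite [cop (hau A x)](hautD A) sw_sw //.
by apply: eq_sw => u v; rewrite sw_tens.
Qed.

Lemma sw_cop_hauV b A x : bilin b ->
  sweedler b (cop (hauV A x)) = \sw_(u, v <- cop x) b (hauV A u) (hauV A v).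
Proof. exact: (@sw_cop_hau b A^-1%g). Qed.

Lemma sw_cop_mulh b x y : bilin b ->
  sweedler b (cop (mulh x y)) =
  \sw_(u, v <- cop x) \sw_(u', v' <- cop y) b (mulh u u') (mulh v v').
Proof.
move=> hb; rewrite [cop (mulh x y)](hombialg_DeltaM (hopf_bialg H)) sw_sw //.
apply: eq_sw => u v; rewrite sw_sw //.
by apply: eq_sw => u' v'; rewrite sw_tens.
Qed.

Lemma sw_cop_one b : bilin b -> sweedler b (cop (oneh H)) = b (oneh H) (oneh H).
Proof. by move=> hb; rewrite [cop _](hombialg_Delta1 (hopf_bialg H)) sw_tens. Qed.

Lemma sw_coac_mum M (b : M -> H -> W) m : bilin b ->
  sweedler b (coac (mum m)) = \sw_(u, v <- coac m) b (mum u) (al v).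
Proof.
move=> hb; rewrite [coac (mum m)](homcomod_mu (yd_comodule (mhyd_YD M))) sw_sw //.
by apply: eq_sw => u v; rewrite sw_tens.
Qed.

Lemma sw_coac_mumV M (b : M -> H -> W) m : bilin b ->
  sweedler b (coac (mumV m)) = \sw_(u, v <- coac m) b (mumV u) (alV v).
Proof.
move=> hb; rewrite -{2}[m]mumKV sw_coac_mum; last by lin.
by apply: eq_sw => u v; rewrite mumVK alVK.
Qed.

Lemma sw_coac_mhyd M N (f : mhydHom M N) (b : N -> H -> W) m : bilin b ->
  sweedler b (coac (f m)) = \sw_(u, v <- coac m) b (f u) v.
Proof.
move=> hb; rewrite [coac (f m)](ydhom_coact (mhyd_ydHom f)) sw_sw //.
by apply: eq_sw => u v; rewrite sw_tens.
Qed.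

Lemma sw_coac_actm M (b : M -> H -> W) h m : bilin b ->
  sweedler b (coac (actm h m)) =
  \sw_(h1, h2 <- cop h) \sw_(h21, h22 <- cop h2) \sw_(m0, m1 <- coac m)
    b (actm (al h21) m0)
      (mulh (mulh (hau (gB (mhyd_deg M)) h22) (alV m1))
        (hau (gA (mhyd_deg M)) (antV h1))).
Proof.
move=> hb; rewrite [coac _](yd_compat (mhyd_YD M)) sw_sw //.
apply: eq_sw => h1 h2; rewrite sw_sw //; apply: eq_sw => h21 h22.
by rewrite sw_sw //; apply: eq_sw => m0 m1; rewrite sw_tens.
Qed.

End Binder.

(** Coassociativity tested against a trilinear map, oriented so that coproducts
    nest to the right; the shift by [alpha] is moved to the other two legs. *)
Lemma sw_coassoc W (F : H -> H -> H -> W) c : trilin F ->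
  \sw_(c1, c2 <- cop c) \sw_(c11, c12 <- cop c1) F c11 c12 c2 =
  \sw_(c1, c2 <- cop c) \sw_(c21, c22 <- cop c2) F (alV c1) c21 (al c22).
Proof.
move=> hF; pose G := sweedler (fun a => sweedler (fun b c => F a b (al c))).
have hG : islin G by rewrite /G; lin.
have := congr1 G (homcoalg_coassoc coalg c).
rewrite !(lin_sw _ _ hG) => e; apply: etrans (esym _) (etrans (esym e) _).
  apply: eq_sw => c1 c2; rewrite (lin_sw _ _ hG); apply: eq_sw => c11 c12.
  rewrite /G sw_tens; last by lin.
  by rewrite sw_tens; [rewrite [al _]alKV | lin].
by apply: eq_sw => c1 c2; rewrite /G sw_tens; last by lin.
Qed.

Lemma sw_coac_coassoc M W (F : M -> H -> H -> W) m : trilin F ->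
  \sw_(m0, m1 <- coac m) \sw_(m00, m01 <- coac m0) F m00 m01 m1 =
  \sw_(m0, m1 <- coac m) \sw_(m11, m12 <- cop m1) F (mumV m0) m11 (al m12).
Proof.
move=> hF; pose G := sweedler (fun a => sweedler (fun b c => F a b (al c))).
have hG : islin G by rewrite /G; lin.
have := congr1 G (homcomod_coactA (yd_comodule (mhyd_YD M)) m).
rewrite !(lin_sw _ _ hG) => e; apply: etrans (esym _) (etrans (esym e) _).
  apply: eq_sw => c1 c2; rewrite (lin_sw _ _ hG); apply: eq_sw => c11 c12.
  rewrite /G sw_tens; last by lin.
  by rewrite sw_tens; [rewrite [al _]alKV | lin].
by apply: eq_sw => c1 c2; rewrite /G sw_tens; last by lin.
Qed.

Lemma sw_counitr W (f : H -> W) c : islin f ->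
  \sw_(c1, c2 <- cop c) epsz c2 (f c1) = f (alV c).
Proof.
move=> hf; rewrite /alV -(homcoalg_counitr coalg) (lin_sw _ _ hf).
by apply: eq_sw => u v; rewrite -/(epsz _ _) epsz_lin.
Qed.

Lemma sw_counitl W (f : H -> W) c : islin f ->
  \sw_(c1, c2 <- cop c) epsz c1 (f c2) = f (alV c).
Proof.
move=> hf; rewrite /alV -(homcoalg_counitl coalg) (lin_sw _ _ hf).
by apply: eq_sw => u v; rewrite -/(epsz _ _) epsz_lin.
Qed.

Lemma sw_coac_counit M W (f : M -> W) m : islin f ->
  \sw_(m0, m1 <- coac m) epsz m1 (f m0) = f (mumV m).
Proof.
move=> hf; rewrite /mumV -(homcomod_counit (yd_comodule (mhyd_YD M))) (lin_sw _ _ hf).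
by apply: eq_sw => u v; rewrite -/(epsz _ _) epsz_lin.
Qed.

Lemma sw_antl W (f : H -> W) c : islin f ->
  \sw_(c1, c2 <- cop c) f (mulh (ant c1) c2) = epsz c (f (oneh H)).
Proof.
move=> hf; rewrite -epsz_lin // /epsz -(antipode_left (hopf_antipode H)).
by rewrite (lin_sw _ _ hf).
Qed.

Lemma sw_antr W (f : H -> W) c : islin f ->
  \sw_(c1, c2 <- cop c) f (mulh c1 (ant c2)) = epsz c (f (oneh H)).
Proof.
move=> hf; rewrite -epsz_lin // /epsz -(antipode_right (hopf_antipode H)).
by rewrite (lin_sw _ _ hf).
Qed.

End Rules.

(** * Normal forms of Sweedler sums *)

Section Steps.
Variables (k : fieldType) (H : homHopf k).
Implicit Types (M N : mhydOb H) (A B : hopfAut H) (U V W X : lmodType k).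

Lemma sw_front_step U V U' V' W (b : U -> V -> W) (c : U -> V -> U' -> V' -> W) t t' :
  (forall u v, b u v = sweedler (c u v) t') ->
  sweedler b t = sweedler (fun u' v' => sweedler (fun u v => c u v u' v') t) t'.
Proof. by move=> /eq_sw ->; rewrite sw_exchange. Qed.

(** In the next two lemmas the function [F] is found by unification, once the
    summation over the coproduct of the first leg has been moved outermost. *)
Lemma coassoc_step W (b : H -> H -> W) (F : H -> H -> H -> W) c :
  (forall u v, b u v = sweedler (fun x y => F x y v) (cop u)) -> trilin F ->
  sweedler b (cop c) =
  \sw_(c1, c2 <- cop c) \sw_(c21, c22 <- cop c2) F (alV c1) c21 (al c22).
Proof. by move=> /eq_sw -> /sw_coassoc ->. Qed.

Lemma coac_step M W (b : M -> H -> W) (F : M -> H -> H -> W) c :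
  (forall u v, b u v = sweedler (fun x y => F x y v) (coac u)) -> trilin F ->
  sweedler b (coac c) =
  \sw_(c1, c2 <- coac c) \sw_(c21, c22 <- cop c2) F (mumV c1) c21 (al c22).
Proof. by move=> /eq_sw -> /sw_coac_coassoc ->. Qed.

(** Compositions and inverses of automorphisms have to be split before any
    cancellation rule is tried: unification sees through the group operations, and
    would otherwise cancel inside an unfolded product. *)
Definition hau_groupE :=
  (hau_mulg, hau_invg, hau_1g, hauV_mulg, hauV_invg, hauV_1g).
Definition homalgE :=
  (alVK, alKV, mumVK, mumKV, hauVK, hauKV,
   al_mulh, alV_mulh, mulhA, al_one, alV_one, mul1h, mulh1).
Definition hautE :=
  (hau_mulh, hauV_mulh, hau_one, hauV_one, hau_al, hauV_al, hau_alV, hauV_alV,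
   ant_al, ant_alV, ant_hau, ant_hauV).
Definition moduleE :=
  (mum_actm, mumV_actm, actmA, act1m, mhyd_mum, mhyd_mumV, mhyd_actm,
   epsz_al, epsz_alV, epsz_hau, epsz_hauV, epsz_mulh, epsz_one, sc1, sc_epsz).

Lemma tens_cop U (u : U) (x : H) : u ⊗ cop x = \sw_(x1, x2 <- cop x) u ⊗ (x1 ⊗ x2).
Proof.
by rewrite -{1}[cop x]sw_eta (lin_sw _ _ (_ : islin (fun z => u ⊗ z))) //; lin.
Qed.

Lemma tens_swl U V U' W (b : U -> V -> U') t (w : W) :
  sweedler b t ⊗ w = \sw_(u, v <- t) b u v ⊗ w.
Proof. by rewrite (lin_sw _ _ (_ : islin (fun z => z ⊗ w))) //; lin. Qed.

Lemma tens_swr U V U' W (b : U -> V -> U') t (w : W) :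
  w ⊗ sweedler b t = \sw_(u, v <- t) w ⊗ b u v.
Proof. by rewrite (lin_sw _ _ (_ : islin (fun z => w ⊗ z))) //; lin. Qed.

End Steps.

(** Normalises an expression without Sweedler sums. *)
Ltac sw_leaf :=
  rewrite ?hau_groupE ?homalgE ?hautE ?moduleE ?homalgE ?hautE ?moduleE ?homalgE.

(** On a goal [e = ?r] where [e] is a nest of Sweedler sums, instantiates [?r] with
    the same nest in which the sum over [x] is outermost. *)
Ltac sw_front x :=
  cbv beta;
  lazymatch goal with
  | |- sweedler _ ?t = _ =>
    tryif constr_eq t x then reflexivity
    else (refine (sw_front_step _ _); intros ? ?; sw_front x)
  end.

(** Redefined below, once tensor products, conjugates and the unit are known to be
    Yetter-Drinfeld modules, by the rules that unfold them. *)
Ltac sw_norm_object := fail.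

(** On a goal [e = ?r], instantiates [?r] with the normal form of [e].  It descends
    under the summations; on the way back [sw_norm_assoc] looks for a sum over a
    coproduct or coaction of the first leg and removes it by coassociativity. *)
Ltac sw_norm :=
  cbv beta;
  tryif sw_norm_object then sw_norm else
  lazymatch goal with
  | |- sweedler _ (sweedler _ _) = _ => refine (etrans (sw_sw _ _ _) _); [lin | sw_norm]
  | |- sweedler _ (_ ⊗ _) = _ => refine (etrans (sw_tens _ _ _) _); [lin | sw_norm]
  | |- sweedler _ (cop (al _)) = _ =>
      refine (etrans (sw_cop_al _ _) _); [lin | sw_norm]
  | |- sweedler _ (cop (alV _)) = _ =>
      refine (etrans (sw_cop_alV _ _) _); [lin | sw_norm]
  | |- sweedler _ (cop (hau _ _)) = _ =>
      refine (etrans (sw_cop_hau _ _ _) _); [lin | sw_norm]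
  | |- sweedler _ (cop (hauV _ _)) = _ =>
      refine (etrans (sw_cop_hauV _ _ _) _); [lin | sw_norm]
  | |- sweedler _ (cop (mulh _ _)) = _ =>
      refine (etrans (sw_cop_mulh _ _ _) _); [lin | sw_norm]
  | |- sweedler _ (cop (oneh _)) = _ =>
      refine (etrans (sw_cop_one _) _); [lin | sw_norm]
  | |- sweedler _ (coac (mum _)) = _ =>
      refine (etrans (sw_coac_mum _ _) _); [lin | sw_norm]
  | |- sweedler _ (coac (mumV _)) = _ =>
      refine (etrans (sw_coac_mumV _ _) _); [lin | sw_norm]
  | |- sweedler _ (coac (mhyd_fun _ _)) = _ =>
      refine (etrans (sw_coac_mhyd _ _ _) _); [lin | sw_norm]
  | |- sweedler _ (coac (actm _ _)) = _ =>
      refine (etrans (sw_coac_actm _ _ _) _); [lin | sw_norm]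
  | |- sweedler _ _ = _ =>
      refine (etrans (eq_sw (b' := _) _ _) _); [intros ? ?; sw_norm | sw_norm_assoc]
  | |- sweedler _ _ ⊗ _ = _ => refine (etrans (tens_swl _ _ _) _); sw_norm
  | |- _ ⊗ sweedler _ _ = _ => refine (etrans (tens_swr _ _ _) _); sw_norm
  | |- coac _ = _ => refine (etrans (esym (sw_eta _)) _); sw_norm
  | |- _ ⊗ cop _ = _ => refine (etrans (tens_cop _ _) _); sw_norm
  | |- _ => sw_leaf; reflexivity
  end
with sw_norm_assoc :=
  first
  [ lazymatch goal with
    | |- sweedler _ (cop _) = _ =>
        refine (etrans (coassoc_step (F := _) _ _ _) _);
        [let u := fresh in intros u ?; sw_front (cop u) | lin | sw_norm]
    | |- sweedler _ (@coac _ _ ?M _) = _ =>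
        refine (etrans (coac_step (F := _) _ _ _) _);
        [let u := fresh in intros u ?; sw_front (@coac _ _ M u) | lin | sw_norm]
    end
  | reflexivity ].

(** Identifies two normal forms, bringing the outermost summation of the left-hand
    side to the front of the right-hand side at every level. *)
Ltac sw_match :=
  cbv beta;
  lazymatch goal with
  | |- sweedler _ ?t = sweedler _ _ =>
      refine (etrans _ (esym _)); [ | sw_front t ]; apply: eq_sw => ? ?; sw_match
  | |- _ => reflexivity
  end.

(** [sw_lhs] normalises the left-hand side of an equation and [sw_eq] proves an
    equation whose sides have the same normal form. *)
Ltac sw_lhs := refine (etrans _ _); [sw_norm | ].
Ltac sw_eq :=
  refine (etrans (etrans (y := _) _ _) (esym _)); [sw_norm | | sw_norm]; sw_match.

(** * The antipode and its inverse *)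

Section Antipode.
Variables (k : fieldType) (H : homHopf k).
Implicit Types (M N : mhydOb H) (A B : hopfAut H) (U V W X : lmodType k).
Implicit Types (x y : H).

Lemma epszC U x y (u : U) : epsz x (epsz y u) = epsz y (epsz x u).
Proof. by rewrite epsz_lin //; lin. Qed.

Lemma ant_one : ant (oneh H) = oneh H.
Proof.
have := @sw_antl k H H id (oneh H) (@lin_id _ _).
rewrite sw_cop_one; last by lin.
by rewrite mulh1 epsz_one -ant_al al_one.
Qed.

(** The sum of S(a1 b1) (a2 b2) (S(b3) S(a3)) is S(b) S(a) when the first two
    factors are collapsed, and S(ab) when the last four are. *)
Lemma ant_mulh x y : ant (mulh x y) = mulh (ant y) (ant x).
Proof.
have <- : \sw_(a1, a2 <- cop x) \sw_(b1, b2 <- cop y)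
    \sw_(t1, t2 <- cop (mulh a1 b1)) mulh (mulh (ant t1) t2) (mulh (ant b2) (ant a2))
  = mulh (ant y) (ant x).
  transitivity (\sw_(a1, a2 <- cop x) \sw_(b1, b2 <- cop y)
      epsz b1 (epsz a1 (al (mulh (ant b2) (ant a2))))).
    apply: eq_sw => a1 a2; apply: eq_sw => b1 b2.
    rewrite (sw_antl (f := fun z => mulh z (mulh (ant b2) (ant a2)))); last by lin.
    by rewrite epsz_mulh mul1h epszC.
  under eq_sw => a1 a2.
    rewrite (sw_counitl (f := fun b2 => epsz a1 (al (mulh (ant b2) (ant a2)))));
      last by lin.
  over.
  rewrite (sw_counitl (f := fun a2 => al (mulh _ (ant a2)))); last by lin.
  by sw_leaf.
have -> : \sw_(a1, a2 <- cop x) \sw_(b1, b2 <- cop y)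
    \sw_(t1, t2 <- cop (mulh a1 b1)) mulh (mulh (ant t1) t2) (mulh (ant b2) (ant a2)) =
  \sw_(a1, a2 <- cop x) \sw_(b1, b2 <- cop y) \sw_(a21, a22 <- cop a2)
    \sw_(b21, b22 <- cop b2) mulh (al (ant (alV (mulh a1 b1))))
      (mulh (al a21) (mulh (alV (mulh b21 (ant b22))) (ant a22))).
  by sw_eq.
symmetry.
transitivity (\sw_(a1, a2 <- cop x) \sw_(b1, b2 <- cop y) \sw_(a21, a22 <- cop a2)
    epsz b2 (mulh (ant (mulh a1 b1)) (al (mulh a21 (ant a22))))).
  apply: eq_sw => a1 a2; apply: eq_sw => b1 b2; apply: eq_sw => a21 a22.
  rewrite (sw_antr (f := fun z => mulh (al (ant (alV (mulh a1 b1))))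
    (mulh (al a21) (mulh (alV z) (ant a22))))); last by lin.
  by rewrite alV_one mul1h -ant_al alKV al_mulh.
transitivity (\sw_(a1, a2 <- cop x) \sw_(b1, b2 <- cop y)
    epsz b2 (epsz a2 (al (ant (mulh a1 b1))))).
  apply: eq_sw => a1 a2; apply: eq_sw => b1 b2.
  rewrite (sw_antr (f := fun z => epsz b2 (mulh _ (al z)))); last by lin.
  by rewrite al_one mulh1 epszC.
under eq_sw => a1 a2.
  rewrite (sw_counitr (f := fun b1 => epsz a2 (al (ant (mulh a1 b1))))); last by lin.
  over.
rewrite (sw_counitr (f := fun a1 => al (ant (mulh a1 (alV y))))); last by lin.
by rewrite -alV_mulh -ant_al alKV.
Qed.

Hypothesis S_bij : bijective (hS H).

Let antI x y : ant x = ant y -> x = y.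
Proof. by move/(congr1 (@antV k H)); rewrite !antVK. Qed.

Lemma antV_mulh x y : antV (mulh x y) = mulh (antV y) (antV x).
Proof. by apply: antI; rewrite ant_mulh !antKV. Qed.
Lemma antV_one : antV (oneh H) = oneh H.
Proof. by apply: antI; rewrite antKV // ant_one. Qed.
Lemma antV_al x : antV (al x) = al (antV x).
Proof. by apply: antI; rewrite ant_al !antKV. Qed.
Lemma antV_alV x : antV (alV x) = alV (antV x).
Proof. by apply: antI; rewrite ant_alV !antKV. Qed.
Lemma antV_hau A x : antV (hau A x) = hau A (antV x).
Proof. by apply: antI; rewrite ant_hau !antKV. Qed.
Lemma antV_hauV A x : antV (hauV A x) = hauV A (antV x).
Proof. by apply: antI; rewrite ant_hauV !antKV. Qed.

(** As the inverse of an antimultiplicative map, S^-1 is an antipode for the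
    opposite coproduct. *)
Lemma sw_antVl W (f : H -> W) c : islin f ->
  \sw_(c1, c2 <- cop c) f (mulh (antV c2) c1) = epsz c (f (oneh H)).
Proof.
move=> hf; have -> : f (oneh H) = f (antV (oneh H)) by rewrite antV_one.
rewrite -(sw_antl (f := fun z => f (antV z))); last by lin.
by apply: eq_sw => c1 c2; rewrite antV_mulh antVK.
Qed.

Lemma sw_antVr W (f : H -> W) c : islin f ->
  \sw_(c1, c2 <- cop c) f (mulh c2 (antV c1)) = epsz c (f (oneh H)).
Proof.
move=> hf; have -> : f (oneh H) = f (antV (oneh H)) by rewrite antV_one.
rewrite -(sw_antr (f := fun z => f (antV z))); last by lin.
by apply: eq_sw => c1 c2; rewrite antV_mulh antVK.
Qed.

(** The cancellation S^-1(c_2) c_1 ⊗ c_3 = 1 ⊗ c in a coproduct that is nested to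
    the right, as it appears in normal forms.  The powers of [alpha] are those that
    coassociativity and the counit produce. *)
Lemma sw_antV_cancel W (F : H -> H -> W) c : bilin F ->
  \sw_(a, z <- cop c) \sw_(b, w <- cop z) F (mulh (antV b) (alV a)) w =
  F (oneh H) (alV (alV c)).
Proof.
move=> hF; transitivity (\sw_(c1, c2 <- cop c) \sw_(c11, c12 <- cop c1)
    F (mulh (antV c12) c11) (alV c2)).
  by sw_eq.
under eq_sw => c1 c2.
  rewrite (sw_antVl (f := fun z => F z (alV c2))); last by lin.
  over.
by rewrite (sw_counitl (f := fun c2 => F (oneh H) (alV c2))); last by lin.
Qed.

End Antipode.

(** Adds the antimultiplicativity of S and S^-1 to the normalisation of leaves. *)
Ltac sw_leaf ::= rewrite ?hau_groupE ?homalgE ?hautE ?moduleE;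
  repeat match goal with
  | hb : bijective _ |- _ =>
    progress rewrite ?(antV_mulh hb, antV_one hb, antV_al hb, antV_alV hb,
                       antV_hau hb, antV_hauV hb)
  | |- _ => progress rewrite ?(ant_mulh, ant_one)
  | |- _ => progress rewrite ?homalgE ?hautE ?moduleE
  end.

(** * The group of pairs of automorphisms *)

Section Degrees.
Variables (k : fieldType) (H : homHopf k).
Implicit Types d e : autPair H.

Lemma gA_mul d e : gA (d * e)%g = (gA d * gA e)%g.
Proof. by case: d e => [? ?] []. Qed.
Lemma gB_mul d e : gB (d * e)%g = (gB e * (gA e)^-1 * gB d * gA e)%g.
Proof. by case: d e => [? ?] []. Qed.
Lemma gA_inv d : gA d^-1%g = (gA d)^-1%g.
Proof. by case: d. Qed.
Lemma gB_inv d : gB d^-1%g = (gA d * (gB d)^-1 * (gA d)^-1)%g.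
Proof. by case: d. Qed.

Definition degE := (gA_mul, gB_mul, gA_inv, gB_inv).

End Degrees.

(** * The tensor product of Yetter-Drinfeld modules *)

Section TensorOb.
Variables (k : fieldType) (H : homHopf k) (S_bij : bijective (hS H)).
Variables (M N : mhydOb H).
Local Notation A := (gA (mhyd_deg M)).
Local Notation B := (gB (mhyd_deg M)).
Local Notation C := (gA (mhyd_deg N)).
Local Notation D := (gB (mhyd_deg N)).

Definition tensor_mu (x : tensor M N) : tensor M N :=
  \sw_(m, n <- x) mum m ⊗ mum n.
Definition tensor_muV (x : tensor M N) : tensor M N :=
  \sw_(m, n <- x) mumV m ⊗ mumV n.
Definition tensor_act (h : H) (x : tensor M N) : tensor M N :=
  \sw_(h1, h2 <- cop h) \sw_(m, n <- x)
    actm (hau C h1) m ⊗ actm (hau (C^-1 * B * C)%g h2) n.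
Definition tensor_coact (x : tensor M N) : tensor (tensor M N) H :=
  \sw_(m, n <- x) \sw_(m0, m1 <- coac m) \sw_(n0, n1 <- coac n)
    (m0 ⊗ n0) ⊗ mulh n1 m1.

Lemma bilin_tensor_act : bilin tensor_act.
Proof. by rewrite /tensor_act; lin. Qed.

Lemma lin_tensor_coact : islin tensor_coact.
Proof. by rewrite /tensor_coact; lin. Qed.

Lemma tensor_actA a b x :
  tensor_act (al a) (tensor_act b x) = tensor_act (mulh a b) (tensor_mu x).
Proof.
move: x; apply: tensor_lin_ext; rewrite /tensor_act /tensor_mu; try by lin.
by move=> m n; sw_eq.
Qed.

Lemma tensor_mu_act a x :
  tensor_mu (tensor_act a x) = tensor_act (al a) (tensor_mu x).
Proof.
move: x; apply: tensor_lin_ext; rewrite /tensor_act /tensor_mu; try by lin.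
by move=> m n; sw_eq.
Qed.

Lemma tensor_act1 x : tensor_act (oneh H) x = tensor_mu x.
Proof.
move: x; apply: tensor_lin_ext; rewrite /tensor_act /tensor_mu; try by lin.
by move=> m n; sw_eq.
Qed.

Lemma tensor_coactA x :
  \sw_(x0, x1 <- tensor_coact x) tensor_muV x0 ⊗ cop x1 =
  \sw_(x0, x1 <- tensor_coact x) \sw_(x00, x01 <- tensor_coact x0)
    x00 ⊗ (x01 ⊗ alV x1).
Proof.
move: x; apply: tensor_lin_ext; rewrite /tensor_coact /tensor_muV; try by lin.
by move=> m n; sw_eq.
Qed.

Lemma tensor_coact_mu x :
  tensor_coact (tensor_mu x) =
  \sw_(x0, x1 <- tensor_coact x) tensor_mu x0 ⊗ al x1.
Proof.
move: x; apply: tensor_lin_ext; rewrite /tensor_coact /tensor_mu; try by lin.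
by move=> m n; sw_eq.
Qed.

Lemma tensor_counit x :
  \sw_(x0, x1 <- tensor_coact x) epsz x1 x0 = tensor_muV x.
Proof.
move: x; apply: tensor_lin_ext; rewrite /tensor_coact /tensor_muV; try by lin.
move=> m n; sw_lhs.
under eq_sw => m0 m1.
  rewrite (sw_coac_counit (f := fun n0 => epsz m1 (m0 ⊗ n0))); last by lin.
  over.
rewrite (sw_coac_counit (f := fun m0 => m0 ⊗ mumV n)); last by lin.
by symmetry; sw_lhs.
Qed.

(** In the normal form of the left-hand side the six legs of the coproduct of h
    occur as h1, ..., h6, with h1 and h4 under S^-1.  Since the action on N is
    twisted by C^-1 B C, the fourth leg enters as S^-1(BC(h4)), next to BC(h3), and
    the two cancel. *)
Lemma tensor_compat h x : tensor_coact (tensor_act h x) =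
    \sw_(h1, h2 <- cop h) \sw_(h21, h22 <- cop h2) \sw_(x0, x1 <- tensor_coact x)
      tensor_act (al h21) x0 ⊗ mulh
        (mulh (hau (D * C^-1 * B * C)%g h22) (alV x1)) (hau (A * C)%g (antV h1)).
Proof.
move: x; apply: tensor_lin_ext; rewrite /tensor_coact /tensor_act; try by lin.
move=> m n.
(* [s] is the place of the product that cancels, [z] that of the legs h5 and h6. *)
pose F h1 h2 (s z : H) := \sw_(h5, h6 <- cop z)
  \sw_(m0, m1 <- coac m) \sw_(n0, n1 <- coac n)
    actm (hau C h2) m0 ⊗ actm (al (al (al (hau (C^-1 * B * C)%g h5)))) n0 ⊗
    mulh (al (al (al (al (hau (D * C^-1 * B * C)%g h6)))))
      (mulh n1 (mulh (hau (B * C)%g s)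
        (mulh (alV (alV m1)) (alV (alV (alV (hau (A * C)%g (antV h1)))))))).
transitivity (\sw_(h1, h2 <- cop h) \sw_(h21, h22 <- cop h2)
    \sw_(a, z <- cop h22) \sw_(b, w <- cop z) F h1 h21 (mulh (antV b) (alV a)) w).
  by rewrite /F; sw_eq.
under eq_sw => h1 h2.
  under eq_sw => h21 h22.
    rewrite sw_antV_cancel //; last by rewrite /F; lin.
    over.
  over.
by rewrite /F; sw_eq.
Qed.

Lemma tensor_YD :
  is_YD (gA (mhyd_deg M * mhyd_deg N)%g) (gB (mhyd_deg M * mhyd_deg N)%g)
    (yd_tensor B C M N).
Proof.
split; [split|split|].
- exact: bilinE bilin_tensor_act.
- exact: tensor_actA.
- exact: tensor_mu_act.
- exact: tensor_act1.
- exact: lin_tensor_coact.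
- exact: tensor_coactA.
- exact: tensor_coact_mu.
- exact: tensor_counit.
- by rewrite !degE; apply: tensor_compat.
Qed.

End TensorOb.

(** * Conjugate modules *)

Section ConjOb.
Variables (k : fieldType) (H : homHopf k) (S_bij : bijective (hS H)).
Variables (b : autPair H) (N : mhydOb H).
Local Notation A := (gA b).
Local Notation B := (gB b).
Local Notation C := (gA (mhyd_deg N)).
Local Notation D := (gB (mhyd_deg N)).

Definition conj_act (h : H) (n : N) : N := actm (hau (C^-1 * B * C * A^-1)%g h) n.
Definition conj_coact (n : N) : tensor N H :=
  \sw_(n0, n1 <- coac n) n0 ⊗ hau (A * B^-1)%g n1.

Lemma conj_actA x y n : conj_act (al x) (conj_act y n) = conj_act (mulh x y) (mum n).
Proof. by rewrite /conj_act; sw_leaf. Qed.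
Lemma conj_mu_act x n : mum (conj_act x n) = conj_act (al x) (mum n).
Proof. by rewrite /conj_act; sw_leaf. Qed.
Lemma conj_act1 n : conj_act (oneh H) n = mum n.
Proof. by rewrite /conj_act; sw_leaf. Qed.

Lemma conj_coactA n :
  \sw_(x0, x1 <- conj_coact n) mumV x0 ⊗ cop x1 =
  \sw_(x0, x1 <- conj_coact n) \sw_(x00, x01 <- conj_coact x0)
    x00 ⊗ (x01 ⊗ alV x1).
Proof. by rewrite /conj_coact; sw_eq. Qed.

Lemma conj_coact_mu n :
  conj_coact (mum n) = \sw_(x0, x1 <- conj_coact n) mum x0 ⊗ al x1.
Proof. by rewrite /conj_coact; sw_eq. Qed.

Lemma conj_counit n : \sw_(x0, x1 <- conj_coact n) epsz x1 x0 = mumV n.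
Proof.
rewrite /conj_coact; sw_lhs.
by rewrite (sw_coac_counit (f := fun n0 => n0)); last by lin.
Qed.

Lemma bilin_conj_act : bilin conj_act.
Proof. by rewrite /conj_act; lin. Qed.

Lemma lin_conj_coact : islin conj_coact.
Proof. by rewrite /conj_coact; lin. Qed.

Lemma conj_compat h n : conj_coact (conj_act h n) =
    \sw_(h1, h2 <- cop h) \sw_(h21, h22 <- cop h2) \sw_(n0, n1 <- conj_coact n)
        conj_act (al h21) n0 ⊗
          mulh (mulh (hau (gB (b * mhyd_deg N * b^-1)%g) h22) (alV n1))
            (hau (gA (b * mhyd_deg N * b^-1)%g) (antV h1)).
Proof. by rewrite /conj_coact /conj_act !degE; sw_eq. Qed.

Lemma conj_YD : is_YD (gA (b * mhyd_deg N * b^-1)%g) (gB (b * mhyd_deg N * b^-1)%g)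
      (yd_conj (gA b) (gB b) (gA (mhyd_deg N)) N).
Proof.
split; [split|split|].
- exact: bilinE bilin_conj_act.
- exact: conj_actA.
- exact: conj_mu_act.
- exact: conj_act1.
- exact: lin_conj_coact.
- exact: conj_coactA.
- exact: conj_coact_mu.
- exact: conj_counit.
- exact: conj_compat.
Qed.
End ConjOb.

(** * The unit module *)

Section UnitOb.
Variables (k : fieldType) (H : homHopf k) (S_bij : bijective (hS H)).

Definition unit_coact (x : k^o) : tensor k^o H := x ⊗ oneh H.

Lemma unit_coactA x :
  \sw_(x0, x1 <- unit_coact x) x0 ⊗ cop x1 =
  \sw_(x0, x1 <- unit_coact x) \sw_(x00, x01 <- unit_coact x0)
    x00 ⊗ (x01 ⊗ alV x1).
Proof. by rewrite /unit_coact; sw_lhs; symmetry; sw_lhs; symmetry; sw_lhs. Qed.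

(** The right-hand side is x ⊗ h2 S^-1(h1), once the counit has been applied. *)
Lemma unit_compat h x : unit_coact (epsz h x) =
    \sw_(h1, h2 <- cop h) \sw_(h21, h22 <- cop h2) \sw_(x0, x1 <- unit_coact x)
      epsz (al h21) x0 ⊗
        mulh (mulh (hau 1%g h22) (alV x1)) (hau 1%g (antV h1)).
Proof.
rewrite /unit_coact; symmetry; sw_lhs.
transitivity (\sw_(u, v <- cop h) x ⊗ mulh v (antV u)).
  apply: eq_sw => u v; pose f w := x ⊗ mulh (al w) (antV u).
  transitivity (\sw_(u0, v0 <- cop v) epsz u0 (f v0)).
    apply: eq_sw => u0 v0.
    by rewrite (epsz_lin (f := fun z => z ⊗ mulh (al v0) (antV u))) //; lin.
  by rewrite sw_counitl /f ?alKV //; lin.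
rewrite (sw_antVr S_bij (f := fun z => x ⊗ z)); last by lin.
by rewrite (epsz_lin (f := fun z => z ⊗ oneh H)) //; lin.
Qed.

Lemma unit_YD : is_YD 1%g 1%g (yd_unit H).
Proof.
split; [split|split|].
- exact: (bilinE (@bilin_epsz k H k^o)).
- move=> x y m; suff : epsz (al x) (epsz y m) = epsz (mulh x y) m by [].
  by sw_leaf.
- move=> x m; suff : epsz x m = epsz (al x) m by [].
  by sw_leaf.
- move=> m; suff : epsz (oneh H) m = m by [].
  by sw_leaf.
- exact: lin_tensl (@lin_id _ _).
- exact: unit_coactA.
- move=> m; suff : \sw_(x0, x1 <- unit_coact m) x0 ⊗ al x1 = unit_coact m by [].
  by rewrite /unit_coact; sw_lhs.
- move=> m; suff : \sw_(x0, x1 <- unit_coact m) epsz x1 x0 = m by [].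
  by rewrite /unit_coact; sw_lhs.
- exact: unit_compat.
Qed.

Lemma mhyd_obP : mhyd_ob_closed H.
Proof. by split; [exact: tensor_YD | exact: unit_YD | exact: conj_YD]. Qed.

End UnitOb.

(** * Normal forms over tensor products, conjugates and the unit *)

Section Objects.
Variables (k : fieldType) (H : homHopf k) (wo : mhyd_ob_closed H).
Implicit Types (M N P : mhydOb H) (W : lmodType k) (b : autPair H).
Local Notation "M ⊠ N" := (mhyd_tensor wo M N) (at level 40, left associativity).

Lemma mum_tensor M N (m : M) (n : N) : @mum k H (M ⊠ N) (m ⊗ n) = mum m ⊗ mum n.
Proof. by apply: tmap_tens; apply: aut_linear. Qed.
Lemma mumV_tensor M N (m : M) (n : N) : @mumV k H (M ⊠ N) (m ⊗ n) = mumV m ⊗ mumV n.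
Proof. by apply: tmap_tens; apply: autV_linear. Qed.
Lemma actm_tensor M N h (m : M) (n : N) : @actm k H (M ⊠ N) h (m ⊗ n) =
  \sw_(h1, h2 <- cop h) actm (hau (gA (mhyd_deg N)) h1) m ⊗
     actm (hau ((gA (mhyd_deg N))^-1 * gB (mhyd_deg M) * gA (mhyd_deg N))%g h2) n.
Proof.
transitivity (tensor_act h (m ⊗ n)); first by [].
by apply: eq_sw => h1 h2; rewrite sw_tens //; lin.
Qed.
Lemma sw_coac_tensor M N W (f : M ⊠ N -> H -> W) (m : M) (n : N) : bilin f ->
  sweedler f (@coac k H (M ⊠ N) (m ⊗ n)) =
  \sw_(m0, m1 <- coac m) \sw_(n0, n1 <- coac n) f (m0 ⊗ n0) (mulh n1 m1).
Proof.
move=> hf; transitivity (sweedler f (tensor_coact (m ⊗ n))); first by [].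
rewrite /tensor_coact sw_tens; last by lin.
rewrite sw_sw //; apply: eq_sw => m0 m1; rewrite sw_sw //; apply: eq_sw => n0 n1.
by rewrite sw_tens.
Qed.

Lemma mum_conj b N (n : N) : @mum k H (mhyd_conj wo b N) n = mum n.
Proof. by []. Qed.
Lemma mumV_conj b N (n : N) : @mumV k H (mhyd_conj wo b N) n = mumV n.
Proof. by []. Qed.
Lemma actm_conj b N h (n : N) : @actm k H (mhyd_conj wo b N) h n =
  actm (hau ((gA (mhyd_deg N))^-1 * gB b * gA (mhyd_deg N) * (gA b)^-1)%g h) n.
Proof. by []. Qed.
(** [f] takes its argument in the conjugate module on the left-hand side and in
    the module itself on the right-hand side; the cast keeps the two apart. *)
Lemma sw_coac_conj b N W (f : mhyd_conj wo b N -> H -> W) (n : mhyd_conj wo b N) :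
  bilin f -> sweedler f (coac n) =
  \sw_(n0, n1 <- @coac k H N n) (f : N -> H -> W) n0 (hau (gA b * (gB b)^-1)%g n1).
Proof.
move=> hf; transitivity (sweedler f (@conj_coact _ _ b N n)); first by [].
by rewrite sw_sw //; apply: eq_sw => n0 n1; rewrite sw_tens.
Qed.

Lemma deg_tensor M N : mhyd_deg (M ⊠ N) = (mhyd_deg M * mhyd_deg N)%g.
Proof. by []. Qed.
Lemma deg_conj b N : mhyd_deg (mhyd_conj wo b N) = (b * mhyd_deg N * b^-1)%g.
Proof. by []. Qed.
Lemma deg_unit : mhyd_deg (mhyd_unit wo) = 1%g.
Proof. by []. Qed.

Lemma mum_unit (c : k^o) : @mum k H (mhyd_unit wo) c = c.
Proof. by []. Qed.
Lemma mumV_unit (c : k^o) : @mumV k H (mhyd_unit wo) c = c.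
Proof. by []. Qed.
Lemma actm_unit h (c : k^o) : @actm k H (mhyd_unit wo) h c = epsz h c.
Proof. by []. Qed.
Lemma sw_coac_unit W (f : mhyd_unit wo -> H -> W) (c : mhyd_unit wo) : bilin f ->
  sweedler f (@coac k H (mhyd_unit wo) c) = f c (oneh H).
Proof. exact: sw_tens. Qed.
End Objects.

Section PullSums.
Variables (k : fieldType) (H : homHopf k) (M : mhydOb H) (U V : lmodType k).
Implicit Types (b : U -> V -> M) (t : tensor U V).

Lemma mum_sw b t : mum (sweedler b t) = \sw_(u, v <- t) mum (b u v).
Proof. by apply: lin_sw; lin. Qed.
Lemma mumV_sw b t : mumV (sweedler b t) = \sw_(u, v <- t) mumV (b u v).
Proof. by apply: lin_sw; lin. Qed.
Lemma coac_sw b t : coac (sweedler b t) = \sw_(u, v <- t) coac (b u v).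
Proof. by apply: lin_sw; lin. Qed.
Lemma actm_sw h b t : actm h (sweedler b t) = \sw_(u, v <- t) actm h (b u v).
Proof. by apply: (lin_sw (f := actm h)); lin. Qed.
End PullSums.

(** Unfolds, in the subterm [t], one operation of a constructed module or one
    degree, and pulls sums out of the operations. *)
Ltac sw_unfold_object t :=
  lazymatch t with
  | context [@mum _ _ _ (sweedler _ _)] => rewrite mum_sw
  | context [@mumV _ _ _ (sweedler _ _)] => rewrite mumV_sw
  | context [@actm _ _ _ _ (sweedler _ _)] => rewrite actm_sw
  | context [@mum _ _ (mhyd_tensor _ _ _) (_ ⊗ _)] => rewrite mum_tensor
  | context [@mumV _ _ (mhyd_tensor _ _ _) (_ ⊗ _)] => rewrite mumV_tensor
  | context [@actm _ _ (mhyd_tensor _ _ _) _ (_ ⊗ _)] => rewrite actm_tensor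
  | context [sc _ _] => rewrite sc1
  | context [@mum _ _ (mhyd_conj _ _ _) _] => rewrite mum_conj
  | context [@mumV _ _ (mhyd_conj _ _ _) _] => rewrite mumV_conj
  | context [@actm _ _ (mhyd_conj _ _ _) _ _] => rewrite actm_conj
  | context [@mum _ _ (mhyd_unit _) _] => rewrite mum_unit
  | context [@mumV _ _ (mhyd_unit _) _] => rewrite mumV_unit
  | context [@actm _ _ (mhyd_unit _) _ _] => rewrite actm_unit
  | context [mhyd_deg (mhyd_tensor _ _ _)] => rewrite deg_tensor
  | context [mhyd_deg (mhyd_conj _ _ _)] => rewrite deg_conj
  | context [mhyd_deg (mhyd_unit _)] => rewrite deg_unit
  | context [gA (_ * _)%g] => rewrite gA_mul
  | context [gB (_ * _)%g] => rewrite gB_mul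
  | context [gA (_^-1)%g] => rewrite gA_inv
  | context [gB (_^-1)%g] => rewrite gB_inv
  end.

Ltac sw_norm_object ::=
  lazymatch goal with
  | |- sweedler _ ?t = _ =>
    tryif sw_unfold_object t then idtac else
    lazymatch t with
    | @coac _ _ _ (sweedler _ _) => rewrite coac_sw
    | @coac _ _ (mhyd_tensor ?wo ?M ?N) (_ ⊗ _) =>
        refine (etrans (@sw_coac_tensor _ _ wo M N _ _ _ _ _) _); [lin | ]
    | @coac _ _ (mhyd_conj ?wo ?b ?N) _ =>
        refine (etrans (@sw_coac_conj _ _ wo b N _ _ _ _) _); [lin | ]
    | @coac _ _ (mhyd_unit ?wo) _ =>
        refine (etrans (@sw_coac_unit _ _ wo _ _ _ _) _); [lin | ]
    end
  | |- ?t = _ => sw_unfold_object t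
  end.

(** * The structure maps *)

Section StructureMaps.
Variables (k : fieldType) (H : homHopf k).
Implicit Types M N P : mhydOb H.

Definition assocm M N P (x : tensor (tensor M N) P) : tensor M (tensor N P) :=
  \sw_(y, p <- x) \sw_(m, n <- y) mum m ⊗ (n ⊗ mumV p).
Definition assocmV M N P (x : tensor M (tensor N P)) : tensor (tensor M N) P :=
  \sw_(m, y <- x) \sw_(n, p <- y) (mumV m ⊗ n) ⊗ mum p.
Definition lunitm M (x : tensor k^o M) : M :=
  sweedler (fun (c : k^o) m => sc c (mum m)) x.
Definition lunitmV M (m : M) : tensor k^o M := tens (1 : k^o) (mumV m).
Definition runitm M (x : tensor M k^o) : M :=
  sweedler (fun m (c : k^o) => sc c (mum m)) x.
Definition runitmV M (m : M) : tensor M k^o := tens (mumV m) (1 : k^o).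
Definition braidm M N (x : tensor M N) : tensor N M := \sw_(m, n <- x)
  \sw_(n0, n1 <- coac n) mum n0 ⊗ actm (hauV (gB (mhyd_deg M)) n1) (mumV m).
Definition braidmV M N (x : tensor N M) : tensor M N := \sw_(n, m <- x)
  \sw_(n0, n1 <- coac n) actm (hauV (gB (mhyd_deg M)) (ant n1)) (mumV m) ⊗ mum n0.

Lemma lin_assocm M N P : islin (@assocm M N P).
Proof. by rewrite /assocm; lin. Qed.
Lemma lin_lunitm M : islin (@lunitm M).
Proof. by rewrite /lunitm; lin. Qed.
Lemma lin_runitm M : islin (@runitm M).
Proof. by rewrite /runitm; lin. Qed.
Lemma lin_braidm M N : islin (@braidm M N).
Proof. by rewrite /braidm; lin. Qed.

Lemma assocmK M N P : cancel (@assocm M N P) (@assocmV M N P).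
Proof.
apply: tensor3_lin_ext; rewrite /assocm /assocmV; [lin | lin | ].
by move=> m n p; sw_lhs.
Qed.

Lemma assocmVK M N P : cancel (@assocmV M N P) (@assocm M N P).
Proof.
apply: tensor_lin_ext; rewrite /assocm /assocmV; [lin | lin | move=> m y].
by move: y; apply: tensor_lin_ext; [lin | lin | move=> n p; sw_lhs].
Qed.

Lemma lunitmK M : cancel (@lunitm M) (@lunitmV M).
Proof.
apply: lunit_lin_ext; rewrite /lunitm /lunitmV; [lin | lin | move=> m].
by rewrite sw_tens ?sc1 ?mumVK //; lin.
Qed.

Lemma lunitmVK M : cancel (@lunitmV M) (@lunitm M).
Proof. by move=> m; rewrite /lunitm /lunitmV; sw_lhs. Qed.

Lemma runitmK M : cancel (@runitm M) (@runitmV M).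
Proof.
apply: runit_lin_ext; rewrite /runitm /runitmV; [lin | lin | move=> m].
by rewrite sw_tens ?sc1 ?mumVK //; lin.
Qed.

Lemma runitmVK M : cancel (@runitmV M) (@runitm M).
Proof. by move=> m; rewrite /runitm /runitmV; sw_lhs. Qed.

(** The inverse composed with the braiding gives S(n1) n2 acting on m. *)
Lemma braidmK M N : cancel (@braidm M N) (@braidmV M N).
Proof.
apply: tensor_lin_ext; rewrite /braidm /braidmV; [lin | lin | ].
move=> m n; sw_lhs.
under eq_sw => n0 n1.
  under eq_sw => x y do rewrite -hauV_mulh.
  rewrite (sw_antl
    (f := fun z => actm (hauV (gB (mhyd_deg M)) z) (mumV m) ⊗ mum n0)).
    by rewrite hauV_one act1m mumKV; over.
  by lin.
by rewrite (sw_coac_counit (f := fun n0 => m ⊗ mum n0)) ?mumKV //; lin.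
Qed.

Lemma braidmVK M N : cancel (@braidmV M N) (@braidm M N).
Proof.
apply: tensor_lin_ext; rewrite /braidm /braidmV; [lin | lin | ].
move=> n m; sw_lhs.
under eq_sw => n0 n1.
  under eq_sw => x y do rewrite -hauV_mulh.
  rewrite (sw_antr
    (f := fun z => mum n0 ⊗ actm (hauV (gB (mhyd_deg M)) z) (mumV m))).
    by rewrite hauV_one act1m mumKV; over.
  by lin.
by rewrite (sw_coac_counit (f := fun n0 => mum n0 ⊗ m)) ?mumKV //; lin.
Qed.

End StructureMaps.

(** * Linearity and colinearity of the structure maps *)

Section Morphisms.
Variables (k : fieldType) (H : homHopf k) (S_bij : bijective (hS H)).
Variable (wo : mhyd_ob_closed H).
Implicit Types (M N P : mhydOb H) (b : autPair H).
Local Notation "M ⊠ N" := (mhyd_tensor wo M N) (at level 40, left associativity).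
Local Notation φ := (mhyd_conj wo).
Local Notation I := (mhyd_unit wo).

Lemma ydHom_intro M N (f : M -> N) : islin f ->
  (forall m, f (mum m) = mum (f m)) ->
  (forall h m, f (actm h m) = actm h (f m)) ->
  (forall m, coac (f m) = \sw_(m0, m1 <- coac m) f m0 ⊗ m1) ->
  is_ydHom (M := M) (N := N) f.
Proof. by []. Qed.

Lemma tmap_hom M N M' N' (f : mhydHom M M') (g : mhydHom N N') :
  is_ydHom (M := M ⊠ N) (N := M' ⊠ N') (tmap f g).
Proof.
have df := mhyd_same_deg f; have dg := mhyd_same_deg g.
apply: (@ydHom_intro (M ⊠ N) (M' ⊠ N')) => [|x|h x|x].
- exact: tmap_is_linear (ydhom_linear (mhyd_ydHom f)) (ydhom_linear (mhyd_ydHom g)).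
- by move: x; apply: tensor_lin_ext => [||m n]; rewrite /tmap; [lin | lin | sw_eq].
- move: x; apply: tensor_lin_ext => [||m n]; rewrite /tmap; [lin | lin | ].
  by sw_lhs; symmetry; sw_lhs; rewrite -df -dg; sw_match.
- by move: x; apply: tensor_lin_ext => [||m n]; rewrite /tmap; [lin | lin | sw_eq].
Qed.

Lemma assoc_hom M N P :
  is_ydHom (M := M ⊠ N ⊠ P) (N := M ⊠ (N ⊠ P)) (@yd_assoc k H M N P).
Proof.
apply: (@ydHom_intro (M ⊠ N ⊠ P) (M ⊠ (N ⊠ P)) (@assocm k H M N P))
  => [|x|h x|x]; first exact: lin_assocm.
- by move: x; apply: tensor3_lin_ext => [||m n p]; rewrite /assocm; [lin | lin | sw_eq].
- by move: x; apply: tensor3_lin_ext => [||m n p]; rewrite /assocm; [lin | lin | sw_eq].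
- by move: x; apply: tensor3_lin_ext => [||m n p]; rewrite /assocm; [lin | lin | sw_eq].
Qed.

Lemma lunit_hom M : is_ydHom (M := I ⊠ M) (N := M) (@yd_lunit k H M).
Proof.
apply: (@ydHom_intro (I ⊠ M) M (@lunitm k H M)) => [|x|h x|x];
  first exact: lin_lunitm.
- by move: x; apply: lunit_lin_ext => [||m]; rewrite /lunitm; [lin | lin | sw_eq].
- move: x; apply: lunit_lin_ext => [||m]; rewrite /lunitm; [lin | lin | ].
  sw_lhs; rewrite (sw_counitl (f := fun h2 => actm (al h2) (mum m))); last lin.
  by symmetry; sw_lhs; rewrite alKV.
- by move: x; apply: lunit_lin_ext => [||m]; rewrite /lunitm; [lin | lin | sw_eq].
Qed.

Lemma runit_hom M : is_ydHom (M := M ⊠ I) (N := M) (@yd_runit k H M).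
Proof.
apply: (@ydHom_intro (M ⊠ I) M (@runitm k H M)) => [|x|h x|x];
  first exact: lin_runitm.
- by move: x; apply: runit_lin_ext => [||m]; rewrite /runitm; [lin | lin | sw_eq].
- move: x; apply: runit_lin_ext => [||m]; rewrite /runitm; [lin | lin | ].
  sw_lhs; rewrite (sw_counitr (f := fun h1 => actm (al h1) (mum m))); last lin.
  by symmetry; sw_lhs; rewrite alKV.
- by move: x; apply: runit_lin_ext => [||m]; rewrite /runitm; [lin | lin | sw_eq].
Qed.

Lemma conj_hom b N N' (f : mhydHom N N') :
  is_ydHom (M := φ b N) (N := φ b N') f.
Proof.
have df := mhyd_same_deg f.
apply: (@ydHom_intro (φ b N) (φ b N')) => [|n|h n|n].
- exact: (ydhom_linear (mhyd_ydHom f)).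
- exact: (mhyd_mum f).
- by rewrite !actm_conj df; apply: (mhyd_actm f).
- move: n; suff : forall n : N, @coac k H (φ b N') (f n) =
    \sw_(n0, n1 <- @coac k H (φ b N) n) f n0 ⊗ n1 by [].
  by move=> n; sw_eq.
Qed.

Section Braiding.
Variables M N : mhydOb H.
Local Notation A := (gA (mhyd_deg M)).
Local Notation B := (gB (mhyd_deg M)).
Local Notation C := (gA (mhyd_deg N)).
Local Notation D := (gB (mhyd_deg N)).
Local Notation MN := (φ (mhyd_deg M) N).

(** By the Yetter-Drinfeld condition for N, the element acting on m contains
    C(S^-1(h2)), where h2 comes from the action of h on n, next to C(h1), which
    comes from the action of h on m; they cancel. *)
Lemma braid_actm h (x : tensor M N) :
  braidm (@actm k H (M ⊠ N) h x) = @actm k H (MN ⊠ M) h (braidm x).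
Proof.
move: x; apply: tensor_lin_ext => [||m n]; rewrite /braidm; [lin | lin | ].
pose F s w := \sw_(h3, h4 <- cop w) \sw_(n0, n1 <- coac n)
  actm (al (al (hau (C^-1 * B * C)%g h3))) (mum n0) ⊗
  actm (mulh (al (hau (B^-1 * D * C^-1 * B * C)%g h4))
         (mulh (alV (hauV B n1)) (alV (alV (hau C s))))) m.
transitivity (\sw_(a, z <- cop h) \sw_(b, w <- cop z)
    F (mulh (antV b) (alV a)) w).
  by rewrite /F; sw_eq.
rewrite sw_antV_cancel // /F; last lin.
by sw_eq.
Qed.

(** The coaction of the conjugate of N contributes A B^-1(n1), and the
    Yetter-Drinfeld condition for M contributes A(S^-1(B^-1(n2))); they cancel. *)
Lemma braid_coac (x : tensor M N) : @coac k H (MN ⊠ M) (braidm x) =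
  \sw_(x0, x1 <- @coac k H (M ⊠ N) x) @braidm k H M N x0 ⊗ x1.
Proof.
move: x; apply: tensor_lin_ext => [||m n]; rewrite /braidm; [lin | lin | ].
pose F (n0 : N) s w := \sw_(h3, h4 <- cop w) \sw_(m0, m1 <- coac m)
  n0 ⊗ actm (al (al (hauV B h3))) (mumV m0) ⊗
  mulh (al (al (al h4))) (mulh (alV m1) (hau A (hauV B s))).
transitivity (\sw_(n0, n1 <- coac n) \sw_(a, z <- cop n1) \sw_(b, w <- cop z)
    F n0 (mulh (antV b) (alV a)) w).
  by rewrite /F; sw_eq.
under eq_sw => n0 n1.
  rewrite sw_antV_cancel // /F; last lin.
  over.
by sw_eq.
Qed.

Lemma braid_hom :
  is_ydHom (M := M ⊠ N) (N := MN ⊠ M) (@yd_braid k H (gB (mhyd_deg M)) M N).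
Proof.
apply: (@ydHom_intro (M ⊠ N) (MN ⊠ M) (@braidm k H M N)) => [|x|h x|x].
- exact: lin_braidm.
- by move: x; apply: tensor_lin_ext => [||m n]; rewrite /braidm; [lin | lin | sw_eq].
- exact: braid_actm.
- exact: braid_coac.
Qed.

End Braiding.

Lemma mhyd_homP : mhyd_hom_closed wo.
Proof.
split; [exact: tmap_hom | exact: assoc_hom | exact: lunit_hom | exact: runit_hom
       | exact: conj_hom | exact: braid_hom].
Qed.

End Morphisms.

(** * Equality of objects and of arrows *)

Section Arrows.
Variables (k : fieldType) (H : homHopf k).
Implicit Types M N : mhydOb H.

(** Agreement of degrees and operations of two modules on the same space, the two
    descriptions of which are identified by [e].  The objects compared below have
    convertible spaces, and there [e] is [erefl]. *)
Definition agree M M' (e : yd_car M = yd_car M') : Prop :=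
  mhyd_deg M = mhyd_deg M' /\
  match e in _ = V return linAut V -> (H -> V -> V) -> (V -> tensor V H) -> Prop with
  | erefl => fun mu act coact =>
    [/\ yd_mu M =1 mu, forall h, @yd_act _ _ M h =1 act h & @yd_coact _ _ M =1 coact]
  end (yd_mu M') (@yd_act _ _ M') (@yd_coact _ _ M').

Definition same_fun M M' N N' (e : yd_car M = yd_car M') (e' : yd_car N = yd_car N')
    (f : M -> N) : (M' -> N') -> Prop :=
  match e in _ = V return (V -> N') -> Prop with
  | erefl => match e' in _ = W return (M -> W) -> Prop with
    | erefl => fun f' => f =1 f'
    end
  end.

Lemma agree_eq M M' (e : yd_car M = yd_car M') : agree e -> M = M'.
Proof.
case: M M' e => [d [V mu a r] y] [d' [V' mu' a' r'] y'] /= e.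
case: V' / e mu' a' r' y' => mu' a' r' y' [/= ed [/linAut_eq emu ea er]].
have {}ea : a = a' by apply/funext => h; apply/funext/ea.
have {}er : r = r' by apply/funext.
by move: y'; rewrite -ed -emu -ea -er => y'; rewrite (Prop_irrelevance y y').
Qed.

(** Once the objects are identified, [e] and [e'] are proofs of [V = V], hence
    [erefl] by proof irrelevance. *)
Lemma arrow_eq M M' N N' (e : yd_car M = yd_car M') (e' : yd_car N = yd_car N')
    (f : mhydHom M N) (f' : mhydHom M' N') :
  M = M' -> N = N' -> same_fun e e' f f' ->
  Arrow (C := mhydCat H) f = Arrow (C := mhydCat H) f'.
Proof.
move=> EM EN; case: M' / EM e f' => e f'; case: N' / EN e' f' => e' f'.
rewrite (Prop_irrelevance e erefl) (Prop_irrelevance e' erefl) /= => ff'.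
by congr Arrow; apply: mhydHom_eq.
Qed.

Lemma inv_ydHom (M N : mhydOb H) (f : M -> N) (g : N -> M) :
  cancel f g -> cancel g f -> is_ydHom f -> is_ydHom g.
Proof.
move=> fK gK [fl fmu fa fc]; have gl : linear g.
  by move=> c x y; apply: (can_inj fK); rewrite fl !gK.
split=> // [m|h m|m].
- by apply: (can_inj fK); rewrite fmu !gK.
- by apply: (can_inj fK); rewrite fa !gK.
have idl (U : lmodType k) : linear (id : U -> U) by [].
rewrite -{2}[m]gK fc -/(tmap f id _) -/(tmap g id _) tmap_comp //.
by rewrite tmap_id.
Qed.

Lemma mhyd_iso M N (f : mhydHom M N) (g : N -> M) :
  cancel f g -> cancel g f -> is_iso (C := mhydCat H) f.
Proof.
move=> fK gK; have gh := inv_ydHom fK gK (mhyd_ydHom f).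
pose g' := MhydHom (esym (mhyd_same_deg f)) gh.
by exists g'; split; apply: mhydHom_eq => x /=; rewrite ?fK ?gK.
Qed.

(** An inverse picked by choice is computed by any inverse function, since
    inverses are unique. *)
Lemma inv_homE M N (f : mhydHom M N) (fiso : is_iso (C := mhydCat H) f) (g : N -> M) :
  cancel f g -> mhyd_fun (inv_hom fiso) =1 g.
Proof.
move=> fK n; rewrite /inv_hom; case: (cid fiso) => h /= [_ fh].
have e : f (h n) = n := congr1 (fun u : mhydHom N N => u n) fh.
by rewrite -[in RHS]e fK.
Qed.

End Arrows.

Ltac same_carrier :=
  lazymatch goal with |- ?M = ?N => apply: (@agree_eq _ _ M N erefl) end.

(** * Identities between the structure maps *)

Section Coherence.
Variables (k : fieldType) (H : homHopf k).
Variable (wo : mhyd_ob_closed H).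
Implicit Types (M N P Q : mhydOb H) (b : autPair H).
Local Notation "M ⊠ N" := (mhyd_tensor wo M N) (at level 40, left associativity).
Local Notation φ := (mhyd_conj wo).
Local Notation I := (mhyd_unit wo).

Lemma hexagon1 M N P x : @braidm k H (M ⊠ N) P x =
  @assocm k H (φ (mhyd_deg M) (φ (mhyd_deg N) P)) M N
    (tmap (@braidm k H M (φ (mhyd_deg N) P)) id
      (@assocmV k H M (φ (mhyd_deg N) P) N
        (tmap id (@braidm k H N P) (@assocm k H M N P x)))).
Proof.
move: x; apply: tensor3_lin_ext; rewrite /braidm /assocm /assocmV /tmap; [lin | lin |].
by move=> m n p; sw_eq.
Qed.

Lemma hexagon2 M N P x : @braidm k H M (N ⊠ P) x =
  @assocmV k H (φ (mhyd_deg M) N) (φ (mhyd_deg M) P) M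
    (tmap id (@braidm k H M P)
      (@assocm k H (φ (mhyd_deg M) N) M P
        (tmap (@braidm k H M N) id (@assocmV k H M N P x)))).
Proof.
move: x; apply: tensor_lin_ext; rewrite /braidm /assocm /assocmV /tmap; [lin | lin |].
move=> m y; move: y; apply: tensor_lin_ext; [lin | lin | move=> n p].
by sw_eq.
Qed.

Lemma pentagonm M N P Q x :
  @assocm k H M N (P ⊠ Q) (@assocm k H (M ⊠ N) P Q x) =
  tmap id (@assocm k H N P Q) (@assocm k H M (N ⊠ P) Q (tmap (@assocm k H M N P) id x)).
Proof.
move: x; apply: tensor4_lin_ext; rewrite /assocm /tmap; [lin | lin |].
by move=> m n p q; sw_lhs; symmetry; sw_lhs.
Qed.

Lemma assocm_nat M N P M' N' P' (f : mhydHom M M') (g : mhydHom N N')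
  (h : mhydHom P P') x :
  tmap f (tmap g h) (assocm x) = assocm (tmap (tmap f g) h x).
Proof.
move: x; apply: tensor3_lin_ext; rewrite /assocm /tmap; [lin | lin |].
by move=> m n p; sw_eq.
Qed.

Lemma braidm_nat M N M' N' (f : mhydHom M M') (g : mhydHom N N') x :
  tmap g f (braidm x) = braidm (tmap f g x).
Proof.
have df := mhyd_same_deg f.
move: x; apply: tensor_lin_ext; rewrite /braidm /tmap; [lin | lin |].
by move=> m n; sw_lhs; symmetry; sw_lhs; rewrite -df.
Qed.

Lemma braidm_conj b M N x :
  @braidm k H M N x = @braidm k H (φ b M) (φ b N) x.
Proof.
move: x; apply: tensor_lin_ext; rewrite /braidm; [lin | lin |].
by move=> m n; sw_eq.
Qed.

Lemma conj_tensor b M N : φ b (M ⊠ N) = φ b M ⊠ φ b N.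
Proof.
same_carrier; split; first by rewrite /= !mulgA mulgVK.
split=> //.
- move=> h; suff : forall x, @actm k H (φ b (M ⊠ N)) h x =
    @actm k H (φ b M ⊠ φ b N) h x by [].
  by apply: tensor_lin_ext; [lin | lin | move=> m n; sw_eq].
- suff : forall x, @coac k H (φ b (M ⊠ N)) x =
    @coac k H (φ b M ⊠ φ b N) x by [].
  by apply: tensor_lin_ext; [lin | lin | move=> m n; sw_eq].
Qed.

Lemma conj_unit b : φ b I = I.
Proof.
same_carrier; split; first by rewrite /= mulg1 mulgV.
split=> //.
- move=> h; suff : forall x : k^o, @actm k H (φ b I) h x = @actm k H I h x by [].
  by move=> c; sw_lhs; symmetry; sw_lhs.
- suff : forall x : k^o, @coac k H (φ b I) x = @coac k H I x by [].
  by move=> c; sw_lhs; symmetry; sw_lhs.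
Qed.

Lemma conj_conj b b' M : φ b (φ b' M) = φ (b * b')%g M.
Proof.
same_carrier; split; first by rewrite /= !invgM !mulgA.
split=> //.
- move=> h; suff : forall x : M, @actm k H (φ b (φ b' M)) h x =
    @actm k H (φ (b * b')%g M) h x by [].
  by move=> c; sw_lhs; symmetry; sw_lhs.
- suff : forall x : M, @coac k H (φ b (φ b' M)) x =
    @coac k H (φ (b * b')%g M) x by [].
  by move=> c; sw_eq.
Qed.

Lemma conj_one M : φ 1%g M = M.
Proof.
same_carrier; split; first by rewrite /= invg1 mulg1 mul1g.
split=> //.
- move=> h; suff : forall x : M, @actm k H (φ 1%g M) h x = @actm k H M h x by [].
  by move=> c; sw_lhs.
- suff : forall x : M, @coac k H (φ 1%g M) x = @coac k H M x by [].
  by move=> c; sw_eq.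
Qed.

Lemma lunitm_nat M N (f : mhydHom M N) x : f (lunitm x) = lunitm (tmap id f x).
Proof.
move: x; apply: lunit_lin_ext; rewrite /lunitm /tmap; [lin | lin | move=> m].
by rewrite sw_tens ?sc1; [symmetry; sw_lhs; rewrite mhyd_mum | lin].
Qed.

Lemma runitm_nat M N (f : mhydHom M N) x : f (runitm x) = runitm (tmap f id x).
Proof.
move: x; apply: runit_lin_ext; rewrite /runitm /tmap; [lin | lin | move=> m].
by rewrite sw_tens ?sc1; [symmetry; sw_lhs; rewrite mhyd_mum | lin].
Qed.

Lemma trianglem M N x :
  tmap id (@lunitm k H N) (@assocm k H M I N x) = tmap (@runitm k H M) id x.
Proof.
move: x; apply: tensor_lin_ext; rewrite /lunitm /runitm /assocm /tmap;
  [lin | lin | move=> y n].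
move: y; apply: runit_lin_ext; [lin | lin | move=> m].
by sw_lhs; symmetry; sw_lhs.
Qed.

End Coherence.

(** * The braided T-category *)

(** Reduces an equality of arrows to equalities of sources, targets and functions,
    when the spaces on both sides are convertible. *)
Ltac arrow_by_fun :=
  lazymatch goal with
  | |- @Arrow _ ?M ?N _ = @Arrow _ ?M' ?N' _ =>
    refine (@arrow_eq _ _ M M' N N' erefl erefl _ _ _ _ _)
  end.

Section Assembly.
Variables (k : fieldType) (H : homHopf k).
Variables (wo : mhyd_ob_closed H) (wh : mhyd_hom_closed wo).
Implicit Types (M N P Q : mhydOb H) (b : autPair H).
Local Notation "M ⊠ N" := (mhyd_tensor wo M N) (at level 40, left associativity).
Local Notation φ := (mhyd_conj wo).
Local Notation I := (mhyd_unit wo).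

Lemma MHYD_monoidal : is_monoidal (mhyd_tensorData wh).
Proof.
split.
- by move=> M N; apply: mhydHom_eq => x; apply: tmap_id.
- move=> M M' M'' N N' N'' f' f g' g; apply: mhydHom_eq => x.
  by apply/esym/tmap_comp; exact: (ydhom_linear (mhyd_ydHom _)).
- by move=> M M' N N' P P' f g h; apply: mhydHom_eq => x; apply: assocm_nat.
- by move=> M M' f; apply: mhydHom_eq => x; apply: lunitm_nat.
- by move=> M M' f; apply: mhydHom_eq => x; apply: runitm_nat.
- move=> M N P; apply: (@mhyd_iso _ _ (M ⊠ N ⊠ P) (M ⊠ (N ⊠ P))
    (mhyd_assoc wh M N P) (@assocmV _ _ M N P)); [exact: assocmK | exact: assocmVK].
- move=> M; apply: (@mhyd_iso _ _ (I ⊠ M) M (mhyd_lunit wh M) (@lunitmV _ _ M));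
    [exact: lunitmK | exact: lunitmVK].
- move=> M; apply: (@mhyd_iso _ _ (M ⊠ I) M (mhyd_runit wh M) (@runitmV _ _ M));
    [exact: runitmK | exact: runitmVK].
- by move=> M N P Q; apply: mhydHom_eq => x; exact: (@pentagonm _ _ wo M N P Q x).
- by move=> M N; apply: mhydHom_eq => x; exact: (@trianglem _ _ wo M N x).
Qed.

Lemma conjK b M : φ b (φ b^-1%g M) = M.
Proof. by rewrite conj_conj // mulgV conj_one. Qed.
Lemma conjVK b M : φ b^-1%g (φ b M) = M.
Proof. by rewrite conj_conj // mulVg conj_one. Qed.

Lemma deg_conjV b (g : autPair H) M : mhyd_deg M = (b * g * b^-1)%g ->
  mhyd_deg (φ b^-1%g M) = g.
Proof. by rewrite /= => ->; rewrite invgK !mulgA mulVg mul1g mulgVK. Qed.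

Lemma MHYD_crossed : is_crossed (MHYD wh).
Proof.
split.
- exact: MHYD_monoidal.
- by move=> M N f; apply: mhyd_same_deg f.
- by [].
- move=> b; split.
  + by move=> M N; apply: conj_tensor.
  + by move=> M N M' N' f g; arrow_by_fun => //; apply: conj_tensor.
  + exact: conj_unit.
  + by move=> M N P; arrow_by_fun => //=; rewrite !conj_tensor.
  + by move=> M; arrow_by_fun => //=; rewrite ?conj_tensor ?conj_unit.
  + by move=> M; arrow_by_fun => //=; rewrite ?conj_tensor ?conj_unit.
- move=> b; exists (mhyd_conj_functor wh b^-1%g); split; split.
  + exact: conjK.
  + by move=> M N f; arrow_by_fun => //; apply: conjK.
  + exact: conjVK.
  + by move=> M N f; arrow_by_fun => //; apply: conjVK.
- move=> b b'; split; first by move=> M; apply/esym/conj_conj.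
  by move=> M N f; arrow_by_fun => //; apply/esym/conj_conj.
- move=> b g N; split=> [dN|[M <- <-]] //.
  by exists (φ b^-1%g N); [apply: deg_conjV | apply: conjK].
- move=> b g N N' f; split=> [dN|[M [M' [f0 [<- fE]]]]].
    exists (φ b^-1%g N), (φ b^-1%g N').
    exists (mhyd_conj_mor wh b^-1%g f); split.
      exact: deg_conjV.
    by arrow_by_fun => //; apply: conjK.
  by rewrite -[N](congr1 (@source _) fE).
Qed.

Lemma inv_assocE M N P (h : is_iso (C := mhydCat H) (mhyd_assoc wh M N P)) x :
  mhyd_fun (inv_hom h) x = @assocmV _ _ M N P x.
Proof.
apply: (@inv_homE _ _ (M ⊠ N ⊠ P) (M ⊠ (N ⊠ P)) _ h (@assocmV _ _ M N P)).
exact: assocmK.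
Qed.

Lemma MHYD_braiding (mon : is_monoidal (mhyd_tensorData wh)) :
  is_braiding (C := MHYD wh) mon.
Proof.
split.
- move=> M N; apply: (@mhyd_iso _ _ (M ⊠ N) (φ (mhyd_deg M) N ⊠ M)
    (mhyd_braid wh M N) (@braidmV _ _ M N)); [exact: braidmK | exact: braidmVK].
- move=> M M' N N' f g; arrow_by_fun => //; first by rewrite /= (mhyd_same_deg f).
  by move=> x; exact: (@braidm_nat _ _ M N M' N' f g x).
- move=> M N P; arrow_by_fun => //.
    by rewrite /= conj_conj.
  move=> x /=; rewrite (inv_assocE (tassoc_iso mon _ _ _)).
  exact: (@hexagon1 _ _ wo M N P x).
- move=> M N P; arrow_by_fun => //.
    by rewrite /= conj_tensor.
  move=> x /=; rewrite !(inv_assocE (tassoc_iso mon _ _ _)).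
  exact: (@hexagon2 _ _ wo M N P x).
- move=> b M N; arrow_by_fun => //=.
  + by rewrite conj_tensor.
  + by rewrite conj_tensor // !conj_conj // mulgVK.
  + by move=> x; exact: (@braidm_conj _ _ wo b M N x).
Qed.

End Assembly.

Theorem theorem3p7 (k : fieldType) (H : homHopf k) (S_bij : bijective (hS H)) :
  exists (wo : mhyd_ob_closed H) (wh : mhyd_hom_closed wo),
    is_braided_Tcategory (MHYD wh).
Proof.
exists (mhyd_obP S_bij), (mhyd_homP S_bij _).
by exists (MHYD_crossed _); apply: MHYD_braiding.
Qed.
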